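(* Let $s\in I(\Phi)$, $\sigma\in\mathrm{Inv}^\tau_s(\mathfrak g_{\mathbb R},\mathfrak h_{\mathbb R})$, and let $M$ be a maximal set of pairwise strongly orthogonal roots contained in $\Phi^\sigma_\circledast$ which, among such maximal sets, contains the largest number of long roots. Then there exists $\sigma'\in\mathrm{Inv}^\tau(\mathfrak g_{\mathbb R},\mathfrak h_{\mathbb R})$ such that $\mathfrak g_{\sigma'}\cong\mathfrak g_\sigma$, $\Phi^{\sigma'}_\bullet=\Phi^s_\bullet\cap M^\perp$ and $\Phi^{\sigma'}_\circledast=\emptyset$ (where $M^\perp$ is the set of roots orthogonal to all elements of $M$).
   Context: $\mathfrak g$ is a complex semisimple Lie algebra, $\mathfrak h$ a Cartan subalgebra, $\Phi=\Phi(\mathfrak g,\mathfrak h)$, $\mathfrak h_{\mathbb R}=\{H\in\mathfrak h:\alpha(H)\in\mathbb R\ \forall\alpha\}$; the Killing form gives an inner product on $V=\mathfrak h_{\mathbb R}^*$ in which $\Phi$ is a root system; $I(\Phi)$ is the set of orthogonal involutions of $V$ preserving $\Phi$; for $s\in I(\Phi)$, $\Phi^s_\bullet=\{\alpha:s\alpha=-\alpha\}$. Distinct roots are strongly orthogonal if they are orthogonal and neither their sum nor difference is a root. Fix a Chevalley system $\{(X_\alpha,H_\alpha)\}$: $X_\alpha\in\mathfrak g^\alpha$, $H_\alpha\in\mathfrak h_{\mathbb R}$, $\alpha(H_\beta)\in\mathbb Z$, $[X_\alpha,X_{-\alpha}]=-H_\alpha$, $[H_\alpha,X_{\pm\alpha}]=\pm2X_{\pm\alpha}$,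 with $\mathfrak g_{\mathbb R}=\mathfrak h_{\mathbb R}\oplus\bigoplus_\alpha\mathbb RX_\alpha$ a split real form and $\tau$ ($\tau|_{\mathfrak h_{\mathbb R}}=-\mathrm{id}$, $\tau X_\alpha=X_{-\alpha}$) an involutive automorphism of $\mathfrak g_{\mathbb R}$; $\mathfrak g_u=\{X\in\mathfrak g_{\mathbb R}:\tau X=X\}\oplus i\{X\in\mathfrak g_{\mathbb R}:\tau X=-X\}$. Automorphisms of $\mathfrak g_{\mathbb R}$ are extended anti-$\mathbb C$-linearly to $\mathfrak g$. $\mathrm{Inv}^\tau(\mathfrak g_{\mathbb R},\mathfrak h_{\mathbb R})$ is the set of involutive automorphisms $\sigma$ of $\mathfrak g_{\mathbb R}$ with $\sigma(\mathfrak h_{\mathbb R})=\mathfrak h_{\mathbb R}$, $\sigma(\mathfrak g_u)=\mathfrak g_u$; $\rho(\sigma)$ is $\alpha\mapsto\alpha\circ\sigma^{-1}|_{\mathfrak h_{\mathbb R}}$; $\mathrm{Inv}^\tau_s=\{\sigma:\rho(\sigma)=s\}$; $\mathfrak g_\sigma=\{X\in\mathfrak g_{\mathbb R}:\sigma X=X\}\oplus i\{X\in\mathfrak g_{\mathbb R}:\sigma X=-X\}$. For $\sigma\in\mathrm{Inv}^\tau(\mathfrak g_{\mathbb R},\mathfrak h_{\mathbb R})$ with $s=\rho(\sigma)$ and $\alpha\in\Phi^s_\bullet$ one has $\sigma(X_\alpha)=\pm X_{-\alpha}$; $\Phi^\sigma_\bullet$ (compact imaginary roots) is the set of $\alpha\in\Phi^s_\bullet$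 with $\sigma(X_\alpha)=X_{-\alpha}$ and $\Phi^\sigma_\circledast$ (noncompact imaginary roots) the set with $\sigma(X_\alpha)=-X_{-\alpha}$. *)

(* Defs.v *)
From HB Require Import structures.
From mathcomp Require Import all_boot all_order all_algebra.
From mathcomp Require Import boolp.
From mathcomp Require Import reals.
From Stdlib Require Import Relation_Operators.
Set Implicit Arguments. Unset Strict Implicit. Unset Printing Implicit Defensive.
Import Order.TTheory GRing.Theory Num.Theory.
Local Open Scope ring_scope.

(* Model: the split real form g_R is a finite-dimensional real vector space
   V (a vectType) with bracket br; the Cartan subalgebra h_R is a subspace h;
   the complexification g = g_R (+) i g_R is modelled as pairs (X, Y) = X + iY;
   V* = h_R^* is 'Hom(subvs_of h, R^o). *)
Section LieDefs.
Variables (R : realType) (V : vectType R) (br : V -> V -> V) (h : {vspace V}).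

Definition hR := subvs_of h.
Definition dualh := 'Hom(hR, R^o).

Definition is_lie_algebra :=
  [/\ forall (a : R) X Y Z, br (a *: X + Y) Z = a *: br X Z + br Y Z,
      forall (a : R) X Y Z, br X (a *: Y + Z) = a *: br X Y + br X Z,
      forall X, br X X = 0
    & forall X Y Z, br X (br Y Z) + br Y (br Z X) + br Z (br X Y) = 0].

Definition ad (X : V) : 'End(V) := linfun (br X).
Definition gbasis := vbasis (fullv : {vspace V}).
Definition ltrace (f : 'End(V)) : R :=
  \sum_(i < \dim (fullv : {vspace V})) coord gbasis i (f (tnth gbasis i)).
Definition killing (X Y : V) : R := ltrace (ad X \o ad Y)%VF.

(* semisimple: Killing form nondegenerate *)
Definition killing_nondeg := forall X, (forall Y, killing X Y = 0) -> X = 0.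

Definition in_rootspace (alpha : dualh) (X : V) :=
  forall H : hR, br (vsval H) X = (alpha H : R) *: X.

Definition is_root (alpha : dualh) :=
  alpha != 0 /\ exists X, X != 0 /\ in_rootspace alpha X.

(* inner product on V = h_R^* induced by the Killing form:
   <alpha, beta> = a G^{-1} b^T where G is the Gram matrix of the Killing
   form on a basis of h_R and a, b are the coordinate rows of alpha, beta. *)
Definition hbasis := vbasis (fullv : {vspace hR}).
Definition gram : 'M[R]_(\dim (fullv : {vspace hR})) :=
  \matrix_(i, j) killing (vsval (tnth hbasis i)) (vsval (tnth hbasis j)).
Definition coordrow (alpha : dualh) : 'rV[R]_(\dim (fullv : {vspace hR})) :=
  \row_i (alpha (tnth hbasis i) : R).
Definition ip (alpha beta : dualh) : R :=
  (coordrow alpha *m invmx gram *m (coordrow beta)^T) 0 0.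

Definition strongly_orth (alpha beta : dualh) :=
  [/\ alpha != beta, ip alpha beta = 0,
      ~ is_root (alpha + beta) & ~ is_root (alpha - beta)].

Definition root_link (alpha beta : dualh) :=
  is_root alpha /\ is_root beta /\ ip alpha beta <> 0.
Definition same_component := clos_refl_trans dualh root_link.
Definition long_root (alpha : dualh) :=
  is_root alpha /\
  forall beta, is_root beta -> same_component alpha beta ->
    ip beta beta <= ip alpha alpha.

Definition in_IPhi (s : 'End(dualh)) :=
  [/\ forall alpha, s (s alpha) = alpha,
      forall alpha beta, ip (s alpha) (s beta) = ip alpha beta,
      forall alpha, is_root alpha -> is_root (s alpha)
    & forall beta, is_root beta -> exists alpha, is_root alpha /\ s alpha = beta].

Definition lie_aut (f : 'End(V)) :=
  (forall X Y, f (br X Y) = br (f X) (f Y)) /\ limg f = fullv.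
Definition lie_inv (f : 'End(V)) :=
  lie_aut f /\ forall X, f (f X) = X.

Definition chevalley_system (Xc : dualh -> V) (Hc : dualh -> hR) (tau : 'End(V)) :=
  [/\ is_lie_algebra /\ killing_nondeg,
      forall H1 H2 : hR, br (vsval H1) (vsval H2) = 0,
      exists rs : seq dualh,
        [/\ uniq rs, forall alpha, is_root alpha <-> alpha \in rs,
            free [seq Xc a | a <- rs],
            (h :&: span [seq Xc a | a <- rs] = 0)%VS
          & (h + span [seq Xc a | a <- rs] = fullv)%VS],
      forall alpha, is_root alpha ->
        [/\ in_rootspace alpha (Xc alpha),
            forall beta, is_root beta -> (beta (Hc alpha) : R) \is a Num.int,
            br (Xc alpha) (Xc (- alpha)) = - vsval (Hc alpha),
            br (vsval (Hc alpha)) (Xc alpha) = 2%:R *: Xc alpha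
          & br (vsval (Hc alpha)) (Xc (- alpha)) = - (2%:R *: Xc (- alpha))]
    & [/\ lie_inv tau, forall H : hR, tau (vsval H) = - vsval H
        & forall alpha, is_root alpha -> tau (Xc alpha) = Xc (- alpha)]].

(* complexification g = g_R + i g_R as pairs (X, Y) = X + iY *)
Definition cbr (z w : V * V) : V * V :=
  (br z.1 w.1 - br z.2 w.2, br z.1 w.2 + br z.2 w.1).
(* anti-C-linear extension of an automorphism f of g_R *)
Definition antiext (f : 'End(V)) (z : V * V) : V * V := (f z.1, - f z.2).
Definition gform (f : 'End(V)) (z : V * V) : Prop := f z.1 = z.1 /\ f z.2 = - z.2.

Definition in_Inv_tau (tau sigma : 'End(V)) :=
  [/\ lie_inv sigma, (sigma @: h)%VS = h,
      forall z, gform tau z -> gform tau (antiext sigma z)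
    & forall w, gform tau w -> exists z, gform tau z /\ antiext sigma z = w].

Definition rho (sigma : 'End(V)) (alpha : dualh) : dualh :=
  linfun (fun H : hR => (alpha (vsproj h ((sigma^-1)%VF (vsval H))) : R^o)).

Definition imag_root (s : dualh -> dualh) (alpha : dualh) :=
  is_root alpha /\ s alpha = - alpha.
Definition compact_root (Xc : dualh -> V) (sigma : 'End(V)) alpha :=
  imag_root (rho sigma) alpha /\ sigma (Xc alpha) = Xc (- alpha).
Definition noncompact_root (Xc : dualh -> V) (sigma : 'End(V)) alpha :=
  imag_root (rho sigma) alpha /\ sigma (Xc alpha) = - Xc (- alpha).

Definition so_noncompact (Xc : dualh -> V) (sigma : 'End(V)) (M : seq dualh) :=
  [/\ uniq M, forall a, a \in M -> noncompact_root Xc sigma a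
    & forall a b, a \in M -> b \in M -> a != b -> strongly_orth a b].
Definition maximal_so (Xc : dualh -> V) sigma (M : seq dualh) :=
  so_noncompact Xc sigma M /\
  forall M', so_noncompact Xc sigma M' -> {subset M <= M'} -> {subset M' <= M}.
Definition nlong (M : seq dualh) : nat := count (fun a => `[< long_root a >]) M.

Definition real_forms_iso (f1 f2 : 'End(V)) :=
  exists phi : V * V -> V * V,
  [/\ forall z, gform f1 z -> gform f2 (phi z),
      forall (a : R) z w, gform f1 z -> gform f1 w ->
        phi (a *: z.1 + w.1, a *: z.2 + w.2) =
        (a *: (phi z).1 + (phi w).1, a *: (phi z).2 + (phi w).2),
      forall z w, gform f1 z -> gform f1 w -> phi z = phi w -> z = w,
      forall w, gform f2 w -> exists z, gform f1 z /\ phi z = w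
    & forall z w, gform f1 z -> gform f1 w -> phi (cbr z w) = cbr (phi z) (phi w)].

End LieDefs.

(* Main.v *)
(* For a noncompact imaginary root b the element X_b + X_(-b) is fixed by tau
   and negated by sigma. Since the roots of M are strongly orthogonal, the real
   automorphism c = exp(pi/4 ad Z), with Z the sum of X_b + X_(-b) over b in M,
   commutes with tau, satisfies sigma c = c^-1 sigma, and c^2 acts on the Cartan
   subalgebra as the product of the reflections s_b. Hence the conjugate
   sigma' = c sigma c^-1 = c^2 sigma defines a real form isomorphic to that of
   sigma, and its imaginary roots are the imaginary roots of sigma orthogonal
   to M. On the root vector of such a root a, c^2 is the identity if a is strongly
   orthogonal to M and -1 otherwise; in the latter case exactly one b in M has
   a + b and a - b as roots. A noncompact a of the first kind would extend M; a
   compact a of the second kind would let us trade b for the two long noncompact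
   roots a + b and a - b. So every imaginary root of sigma' is compact.

   The reflections, with the integrality of the Cartan integers, also provide
   all the facts on root systems that are needed. *)
Require Import Defs.
From HB Require Import structures.
From mathcomp Require Import all_boot all_order all_algebra.
From mathcomp Require Import boolp classical_sets functions reals topology.
From mathcomp Require Import normedtype sequences derive realfun exp trigo.
From mathcomp Require Import zify ring lra.
From Stdlib Require Import Relation_Operators.
Set Implicit Arguments. Unset Strict Implicit. Unset Printing Implicit Defensive.
Import Order.TTheory GRing.Theory Num.Theory.
Import numFieldNormedType.Exports.
Local Open Scope ring_scope.

(** * Exponential of an endomorphism *)

Lemma cvgn_sum (R : realType) m (u : 'I_m -> nat -> R) (l : 'I_m -> R) :
    (forall i, (u i @ \oo --> l i)%classic) ->
  ((fun k => \sum_i u i k) @ \oo --> \sum_i l i)%classic.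
Proof.
move=> ul; rewrite (_ : (fun _ => _) = \sum_i u i); last first.
  by apply/funext => k; rewrite fct_sumE.
by elim/big_ind2 : _ => // [|u1 l1 u2 l2 ? ?]; [exact: cvg_cst|exact: cvgD].
Qed.

Section OperatorExponential.
Variables (R : realType) (V : vectType R).
Local Notation B := (vbasis (fullv : {vspace V})).
Local Notation n := (\dim (fullv : {vspace V})).

Lemma vbasis_fullv_sum (v : V) : v = \sum_(i < n) coord B i v *: B`_i.
Proof. exact: coord_vbasis (memvf v). Qed.

Lemma coord_vbasis_inj (u v : V) :
  (forall i, coord B i u = coord B i v) -> u = v.
Proof.
by move=> e; rewrite (vbasis_fullv_sum u) (vbasis_fullv_sum v);
  apply: eq_bigr => i _; rewrite e.
Qed.

Lemma coord_vbasis_sum (x : 'I_n -> R) j :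
  coord B j (\sum_(i < n) x i *: B`_i) = x j.
Proof. by rewrite coord_sum_free // (basis_free (vbasisP _)). Qed.

Lemma coord_lfunE (f : 'End(V)) (v : V) j :
  coord B j (f v) = \sum_(i < n) coord B i v * coord B j (f B`_i).
Proof.
rewrite {1}(vbasis_fullv_sum v) linear_sum linear_sum /=.
by apply: eq_bigr => i _; rewrite !linearZ.
Qed.

(** The entrywise l^1 norm of the matrix of [f]. It dominates the operator norm of [f] for the sup
    norm on coordinates, and this crude bound is enough for convergence. *)
Definition coord_bound (f : 'End(V)) : R :=
  \sum_(j < n) \sum_(i < n) `|coord B j (f B`_i)|.

Lemma coord_bound_ge0 f : 0 <= coord_bound f.
Proof. by do 2!(apply: sumr_ge0 => ? _). Qed.

Lemma coord_lfun_le (f : 'End(V)) (v : V) m :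
    (forall i, `|coord B i v| <= m) ->
  forall j, `|coord B j (f v)| <= m * coord_bound f.
Proof.
move=> vm j; rewrite coord_lfunE.
have m0 : 0 <= m by exact: le_trans (vm j).
apply: (le_trans (ler_norm_sum _ _ _)).
apply: (@le_trans _ _ (\sum_(i < n) m * `|coord B j (f B`_i)|)).
  by apply: ler_sum => i _; rewrite normrM ler_wpM2r.
rewrite -mulr_sumr ler_wpM2l // /coord_bound [leRHS](bigD1 j) //= lerDl.
by do 2!(apply: sumr_ge0 => ? _).
Qed.

(** Growth beaten by the factorial in [exp_coord]. The sequence [w] is kept general because
    differentiating a series replaces it by its shift. *)
Definition geometric_growth (w : nat -> V) :=
  exists K C, [/\ 0 <= K, 0 <= C & forall k i, `|coord B i (w k)| <= K * C ^+ k].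

Lemma geometric_growth_iter (a : 'End(V)) v :
  geometric_growth (fun k => iter k a v).
Proof.
exists (\sum_(i < n) `|coord B i v|), (coord_bound a); split.
- by apply: sumr_ge0 => ? _.
- exact: coord_bound_ge0.
elim=> [|k ih] j /=.
  by rewrite expr0 mulr1 [leRHS](bigD1 j) //= lerDl; apply: sumr_ge0 => ? _.
by rewrite exprSr mulrA; exact: coord_lfun_le.
Qed.

Lemma geometric_growth_shift w :
  geometric_growth w -> geometric_growth (fun k => w k.+1).
Proof.
move=> [K [C [K0 C0 h]]]; exists (K * C), C; split => //; first exact: mulr_ge0.
by move=> k i; rewrite -mulrA -exprS.
Qed.

Definition exp_coord (w : nat -> V) i := fun k => coord B i (w k) / k`!%:R.

(** Absolute convergence, by comparison with [K] times the real exponential series at [C * |t|]. *)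
Lemma exp_coord_cvg w i t :
  geometric_growth w -> cvgn (pseries (exp_coord w i) t).
Proof.
move=> [K [C [K0 C0 wKC]]]; apply: normed_cvg.
apply: (@series_le_cvg _ _ (fun k => K * exp_coeff (C * `|t|) k)).
- by move=> k /=.
- by move=> k; rewrite mulr_ge0 // exp_coeff_ge0 // mulr_ge0.
- move=> k; rewrite /exp_coord /exp_coeff /= normrM normrM normfV normr_nat.
  rewrite exprMn normrX [in leRHS]mulrA [in leRHS]mulrA mulrAC.
  by rewrite ler_wpM2r ?invr_ge0 // ler_wpM2r // exprn_ge0.
have -> : (fun k => K * exp_coeff (C * `|t|) k) = K *: exp_coeff (C * `|t|) by [].
apply: is_cvg_seriesZ; exact: is_cvg_series_exp_coeff.
Qed.

Definition exp_sum (w : nat -> V) t : V :=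
  \sum_(i < n) limn (pseries (exp_coord w i) t) *: B`_i.

Lemma exp_sum_cvg w t i : geometric_growth w ->
  (pseries (exp_coord w i) t @ \oo --> coord B i (exp_sum w t))%classic.
Proof. by move=> gw; rewrite coord_vbasis_sum; exact: exp_coord_cvg. Qed.

Lemma exp_sum_unique w t v :
    (forall i, (pseries (exp_coord w i) t @ \oo --> coord B i v)%classic) ->
  exp_sum w t = v.
Proof.
move=> wv; apply: coord_vbasis_inj => i; rewrite coord_vbasis_sum.
exact: cvg_lim (wv i).
Qed.

(** In coordinates [f] is a finite matrix, so each partial sum of the left side is a finite
    combination of partial sums for [w], and limits pass through. *)
Lemma exp_sum_lfun (f : 'End(V)) w t : geometric_growth w ->
  exp_sum (f \o w) t = f (exp_sum w t).
Proof.
move=> gw; apply: exp_sum_unique => j; rewrite coord_lfunE.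
rewrite (_ : pseries _ t = (fun m => \sum_(i < n)
   pseries (exp_coord w i) t m * coord B j (f B`_i))); last first.
  apply/funext => m; rewrite /pseries /series /=.
  under [RHS]eq_bigr do rewrite mulr_suml.
  rewrite exchange_big /=; apply: eq_bigr => k _.
  rewrite /exp_coord /= coord_lfunE !mulr_suml; apply: eq_bigr => i _.
  by ring.
apply: cvgn_sum => i.
by apply: cvgMr_tmp; exact: exp_sum_cvg.
Qed.

Lemma exp_sumD w z t : geometric_growth w -> geometric_growth z ->
  exp_sum (fun k => w k + z k) t = exp_sum w t + exp_sum z t.
Proof.
move=> gw gz; apply: exp_sum_unique => j; rewrite linearD /=.
rewrite (_ : pseries _ t =
    pseries (exp_coord w j) t \+ pseries (exp_coord z j) t); last first.
  apply/funext => m; rewrite /pseries /series /= -big_split /=.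
  by apply: eq_bigr => k _; rewrite /exp_coord linearD /= !mulrDl.
by apply: cvgD; exact: exp_sum_cvg.
Qed.

(** Differentiability of a curve is taken coordinate by coordinate, so that [V] needs no norm and
    real calculus applies directly. *)
Definition vderive (u : R -> V) (u' : V) (t : R) :=
  forall i, is_derive t 1 (fun s => coord B i (u s) : R) (coord B i u').

Lemma pseries_diffs_exp_coord w i :
  pseries_diffs (exp_coord w i) = exp_coord (fun k => w k.+1) i.
Proof.
apply/funext => k; rewrite /pseries_diffs /exp_coord factS natrM invfM.
by rewrite mulrCA mulVKf // pnatr_eq0.
Qed.

Lemma vderive_exp_sum w t : geometric_growth w ->
  vderive (exp_sum w) (exp_sum (fun k => w k.+1) t) t.
Proof.
move=> gw i; rewrite coord_vbasis_sum.
rewrite (_ : (fun _ => _) = fun s => limn (pseries (exp_coord w i) s)); last first.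
  by apply/funext => s; rewrite coord_vbasis_sum.
rewrite -pseries_diffs_exp_coord.
have gw1 := geometric_growth_shift gw.
(* Term-by-term differentiation at [t] asks for convergence, at some point of modulus larger than
   [|t|], of the series and of its first two formal derivatives. *)
apply: (@pseries_snd_diffs _ _ (`|t| + 1)).
- exact: exp_coord_cvg.
- by rewrite pseries_diffs_exp_coord; exact: exp_coord_cvg.
- rewrite !pseries_diffs_exp_coord; apply: exp_coord_cvg.
  exact: geometric_growth_shift gw1.
by rewrite [ltRHS]ger0_norm ?ltrDl // addr_ge0.
Qed.

Lemma vderive_eq u u' v' t : vderive u u' t -> u' = v' -> vderive u v' t.
Proof. by move=> du <-. Qed.

Lemma vderive_cst (v : V) t : vderive (fun=> v) 0 t.
Proof. by move=> i; rewrite linear0; exact: is_derive_cst. Qed.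

Lemma vderive_scale (f : R -> R) (f' : R) u u' (t : R) :
    is_derive t 1 f f' -> vderive u u' t ->
  vderive (fun s => f s *: u s) (f' *: u t + f t *: u') t.
Proof.
move=> df du i.
rewrite (_ : (fun _ => _) = (f : R -> R^o) * (fun s => coord B i (u s))); last first.
  by apply/funext => s; rewrite linearZ.
apply: is_derive_eq; first exact: (is_deriveM df (du i)).
rewrite linearD !linearZ /= addrC; congr (_ + _).
by rewrite /GRing.scale /= mulrC.
Qed.

Lemma vderive_sum m (u : 'I_m -> R -> V) u' t :
    (forall i, vderive (u i) (u' i) t) ->
  vderive (fun s => \sum_(i < m) u i s) (\sum_(i < m) u' i) t.
Proof.
move=> du j; rewrite linear_sum.
rewrite (_ : (fun _ => _) =
    \sum_(i < m) (fun s => coord B j (u i s) : R^o)); last first.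
  by apply/funext => s; rewrite linear_sum fct_sumE.
by apply: is_derive_sum => i; exact: du.
Qed.

Lemma vderiveD u v u' v' t : vderive u u' t -> vderive v v' t ->
  vderive (fun s => u s + v s) (u' + v') t.
Proof.
move=> du dv j; rewrite linearD.
rewrite (_ : (fun _ => _) = (fun s => coord B j (u s) : R^o) +
   (fun s => coord B j (v s) : R^o)); last first.
  by apply/funext => s; rewrite linearD.
exact: (is_deriveD (du j) (dv j)).
Qed.

Lemma vderive_lfun (f : 'End(V)) u u' t : vderive u u' t ->
  vderive (fun s => f (u s)) (f u') t.
Proof.
move=> du; rewrite (_ : (fun _ => _) =
    fun s => \sum_(i < n) coord B i (u s) *: f B`_i); last first.
  apply/funext => s; rewrite {1}(vbasis_fullv_sum (u s)) linear_sum.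
  by apply: eq_bigr => i _; rewrite linearZ.
apply: vderive_eq.
  by apply: vderive_sum => i; apply: vderive_scale (du i) (vderive_cst _ _).
rewrite {2}(vbasis_fullv_sum u') linear_sum; apply: eq_bigr => i _.
by rewrite scaler0 addr0 linearZ.
Qed.

Lemma vderive_opp u u' t : vderive u u' (- t) ->
  vderive (fun s => u (- s)) (- u') t.
Proof.
move=> du j; rewrite linearN /=.
have dN : is_derive t 1 (fun s : R => - s) (-1 : R).
  exact: (is_deriveN (is_derive_id t (1 : R))).
apply: is_derive_eq; first exact: (@is_derive1_comp _ _ _ _ _ _ (du j) dN).
by rewrite mulrN1.
Qed.

Lemma vderive0_cst u : (forall t, vderive u 0 t) -> forall t, u t = u 0.
Proof.
move=> du t; apply: coord_vbasis_inj => i.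
apply: (@is_derive_0_is_cst _ (fun s => coord B i (u s))) => s.
by have := du s i; rewrite linear0.
Qed.

(** * The exponential flow and the equation u' = a u *)

Section Exponential.
Variable a : 'End(V).

(* expop t v is exp(t a) v, summed coordinate by coordinate. *)
Definition expop t v := exp_sum (fun k => iter k a v) t.

Let gr v := geometric_growth_iter a v.

Lemma expop_lfun (f : 'End(V)) : (forall v, f (a v) = a (f v)) ->
  forall t v, f (expop t v) = expop t (f v).
Proof.
move=> fa t v; rewrite /expop -exp_sum_lfun //; congr exp_sum.
by apply/funext => k /=; elim: k => //= k <-.
Qed.

Lemma expop_op t v : a (expop t v) = expop t (a v).
Proof. exact: expop_lfun. Qed.

Fact expop_is_linear t : linear (expop t).
Proof.
move=> k u v.
rewrite (_ : expop t (k *: u + v) =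
    exp_sum (fun m => iter m a (k *: u) + iter m a v) t).
  rewrite exp_sumD //; congr (_ + _).
  have := @expop_lfun (k *: \1%VF) _ t u.
  rewrite !scale_lfunE !id_lfunE => -> // w.
  by rewrite !scale_lfunE !id_lfunE linearZ.
congr exp_sum; apply/funext => m; elim: m => //= m ->.
by rewrite linearD.
Qed.
HB.instance Definition _ t :=
  GRing.isLinear.Build R V V _ (expop t) (expop_is_linear t).

Lemma expop0 v : expop 0 v = v.
Proof.
apply: exp_sum_unique => i.
rewrite (_ : coord B i v = limn (fun=> coord B i v)); last by rewrite lim_cst.
apply: cvg_near_cst; exists 1%N => // m /= m1.
rewrite lim_cst // /pseries /series /= big_ltn // /exp_coord /= expr0 mulr1.
rewrite fact0 divr1 big_nat big1 ?addr0 // => k /andP[k0 _].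
by rewrite expr0n; case: k k0 => //= k _; rewrite mulr0.
Qed.

Lemma vderive_expop v t : vderive (expop^~ v) (expop t (a v)) t.
Proof.
apply: vderive_eq; first exact: vderive_exp_sum.
by congr exp_sum; apply/funext => k; rewrite iterSr.
Qed.

Lemma vderive_expopN v t :
  vderive (fun s => expop (- s) v) (- expop (- t) (a v)) t.
Proof. apply: (@vderive_opp (expop^~ v)); exact: vderive_expop. Qed.

(** By the product rule, taken along the coordinates of [u], the derivative of exp(-ta) u(t) is
    exp(-ta) a u - exp(-ta) a u = 0. This is uniqueness for u' = a u, from which the identities
    below follow by checking that both sides solve the equation. *)
Lemma expopN_solution u : (forall t, vderive u (a (u t)) t) ->
  forall t, expop (- t) (u t) = u 0.
Proof.
move=> du t.
have uE s v : expop s v = \sum_(i < n) coord B i v *: expop s B`_i.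
  rewrite {1}(vbasis_fullv_sum v) linear_sum.
  by apply: eq_bigr => i _; rewrite linearZ.
have auE s v : expop s (a v) = \sum_(i < n) coord B i v *: expop s (a B`_i).
  rewrite {1}(vbasis_fullv_sum v) !linear_sum.
  by apply: eq_bigr => i _; rewrite !linearZ.
rewrite (@vderive0_cst (fun s => expop (- s) (u s))) ?oppr0 ?expop0 // => {}t.
rewrite (_ : (fun _ => _) = fun s => \sum_(i < n) coord B i (u s) *: expop (- s) B`_i);
  last by apply/funext.
apply: vderive_eq.
  by apply: vderive_sum => i; apply: vderive_scale (du t i) (vderive_expopN _ _).
rewrite big_split /= -uE.
under eq_bigr do rewrite scalerN.
by rewrite sumrN -auE subrr.
Qed.

Lemma expopNK t v : expop (- t) (expop t v) = v.
Proof.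
rewrite (@expopN_solution (expop^~ v)) ?expop0 // => s.
by rewrite expop_op; exact: vderive_expop.
Qed.

Lemma expop_solution u : (forall t, vderive u (a (u t)) t) ->
  forall t, u t = expop t (u 0).
Proof.
by move=> du t; rewrite -(expopN_solution du t) -{2}[t]opprK expopNK.
Qed.

(** The curve s -> f (exp(-sa) v) solves u' = a u, since the two signs cancel. *)
Lemma expop_anti (f : 'End(V)) : (forall v, f (a v) = - a (f v)) ->
  forall t v, f (expop t v) = expop (- t) (f v).
Proof.
move=> fa t v.
have := @expop_solution (fun s => f (expop (- s) v)) _ (- t).
rewrite oppr0 expop0 opprK; apply => s.
apply: vderive_eq; first exact/vderive_lfun/vderive_expopN.
by rewrite -expop_op linearN /= fa opprK.
Qed.

Lemma expop_ker v : a v = 0 -> forall t, expop t v = v.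
Proof.
move=> av t; symmetry; apply: (@expop_solution (fun=> v)) => s.
by rewrite av; exact: vderive_cst.
Qed.

(** On the plane of [v] and [a v] the square of [a] is -4, so the flow rotates with angular speed 2;
    the right side solves u' = a u with value [v] at 0. *)
Lemma expop_rot v : a (a v) = - (4%:R *: v) ->
  forall t, expop t v = cos (2 * t) *: v + (sin (2 * t) / 2) *: a v.
Proof.
move=> aav t; symmetry.
have := @expop_solution (fun t => cos (2 * t) *: v + (sin (2 * t) / 2) *: a v) _ t.
rewrite mulr0 cos0 sin0 mul0r scale0r scale1r addr0; apply => {}t.
have d2 : is_derive t 1 (fun s : R => 2 * s) (2 : R).
  have := is_deriveZ (2 : R) (is_derive_id t (1 : R)).
  by rewrite [_ *: _]mulr1.
have dc : is_derive t 1 (fun s => cos (2 * s)) (- (2 * sin (2 * t))).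
  apply: (is_derive_eq (is_derive1_comp (is_derive_cos (2 * t)) d2)).
  by ring.
have ds : is_derive t 1 (fun s => sin (2 * s) / 2) (cos (2 * t)).
  rewrite (_ : (fun _ => _) = 2^-1 *: (fun s => sin (2 * s) : R^o)); last first.
    by apply/funext => s; rewrite mulrC.
  apply: (is_derive_eq (is_deriveZ _ (is_derive1_comp (is_derive_sin (2 * t)) d2))).
  by rewrite /GRing.scale /=; field.
apply: vderive_eq.
  apply: vderiveD; first exact: vderive_scale dc (vderive_cst _ _).
  exact: vderive_scale ds (vderive_cst _ _).
rewrite !scaler0 !addr0 linearD !linearZ /= aav addrC; congr (_ + _).
rewrite [RHS]scalerN scalerA -scaleNr; congr (_ *: _).
by rewrite /GRing.scale /=; field.
Qed.

(** The exponential of a derivation is an automorphism: by the Leibniz rule the bracket of two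
    solutions of u' = a u is again a solution. *)
Lemma expop_morph (br : V -> V -> V) :
    (forall (k : R) x y z, br (k *: x + y) z = k *: br x z + br y z) ->
    (forall (k : R) x y z, br x (k *: y + z) = k *: br x y + br x z) ->
    (forall x y, a (br x y) = br (a x) y + br x (a y)) ->
  forall t x y, expop t (br x y) = br (expop t x) (expop t y).
Proof.
move=> brl brr ad t x y; symmetry.
have := @expop_solution (fun s => br (expop s x) (expop s y)) _ t.
rewrite !expop0; apply => {}t.
have br0 z : br 0 z = 0.
  by have := brl (-1) 0 0 z; rewrite scaler0 addr0 scaleN1r addNr.
have brZ k u z : br (k *: u) z = k *: br u z.
  by rewrite -[k *: u]addr0 brl br0 addr0.
have brsum m (u : 'I_m -> V) z : br (\sum_i u i) z = \sum_i br (u i) z.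
  elim/big_ind2 : _ => // _ p _ q <- <-.
  by rewrite -[in LHS](scale1r p) brl scale1r.
(* Expanding the first argument turns the bracket into scalar functions times curves, to which
   [vderive_scale] applies. *)
have bE u v : br u v = \sum_(i < n) coord B i u *: linfun (br B`_i) v.
  rewrite {1}(vbasis_fullv_sum u) brsum.
  apply: eq_bigr => i _; rewrite brZ; congr (_ *: _).
  have lin : linear (br B`_i) by move=> k p q; rewrite brr.
  pose F : {linear V -> V} := HB.pack (br B`_i) (GRing.isLinear.Build _ _ _ _ _ lin).
  by rewrite -[br _]/(F : V -> V) lfunE.
rewrite (_ : (fun _ => _) = fun s => \sum_(i < n) coord B i (expop s x) *:
   linfun (br B`_i) (expop s y)); last by apply/funext.
apply: vderive_eq.
  apply: vderive_sum => i; apply: vderive_scale (vderive_expop x t i) _.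
  exact: vderive_lfun (vderive_expop _ _).
by rewrite ad !expop_op big_split /= -!bE.
Qed.

End Exponential.
End OperatorExponential.

(** At time pi/4 the angle is pi/2, so the exponential acts as a/2 and its square as a^2/4 = -1. *)
Lemma expop_quarter_turn (R : realType) (V : vectType R) (a : 'End(V)) v :
    a (a v) = - (4%:R *: v) ->
  expop a (pi / 4) (expop a (pi / 4) v) = - v.
Proof.
move=> aav.
have quarter w : a (a w) = - (4%:R *: w) -> expop a (pi / 4) w = 2^-1 *: a w.
  move=> /expop_rot ->; have -> : 2 * (pi / 4) = pi / 2 :> R by field.
  by rewrite cos_pihalf sin_pihalf scale0r add0r div1r.
rewrite (quarter v) // linearZ /= quarter; last by rewrite aav linearN linearZ.
rewrite aav scalerA scalerN scalerA; congr (- _).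
by rewrite -[RHS]scale1r; congr (_ *: _); field.
Qed.

(** * Traces and Lie algebras *)

Lemma no_int_between (R : archiRealFieldType) (k : int) (x : R) :
  x \is a Num.int -> k%:~R < x -> x < (k + 1)%:~R -> False.
Proof. by move=> /intrP[m ->]; rewrite !ltr_int; lia. Qed.

Section Trace.
Variables (R : realType) (V : vectType R).
Implicit Types f g : 'End(V).

(** Frees the trace from the fixed basis of its definition, so that it can be computed in a basis of
    root vectors. *)
Lemma ltrace_basis m (b : m.-tuple V) f : basis_of fullv b ->
  ltrace f = \sum_(i < m) coord b i (f b`_i).
Proof.
move=> bb; rewrite /ltrace.
have gb : basis_of fullv (gbasis V) := vbasisP _.
under eq_bigr => i _ do
  rewrite {1}(coord_basis bb (memvf (f _))) linear_sum /=.
rewrite exchange_big /=; apply: eq_bigr => j _.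
under eq_bigr => i _ do rewrite linearZ /= mulrC.
rewrite [in RHS](coord_basis gb (memvf b`_j)) !linear_sum /=.
by apply: eq_bigr => i _; rewrite !linearZ /= (tnth_nth 0).
Qed.

Lemma ltrace_compC f g : ltrace (f \o g)%VF = ltrace (g \o f)%VF.
Proof.
have gb : basis_of fullv (gbasis V) := vbasisP _.
have E f' g' : ltrace (f' \o g')%VF =
    \sum_(i < \dim (fullv : {vspace V})) \sum_(j < \dim (fullv : {vspace V}))
      coord (gbasis V) j (g' (gbasis V)`_i) *
      coord (gbasis V) i (f' (gbasis V)`_j).
  apply: eq_bigr => i _; rewrite comp_lfunE (tnth_nth 0).
  rewrite {1}(coord_basis gb (memvf (g' _))) !linear_sum /=.
  by apply: eq_bigr => j _; rewrite !linearZ.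
rewrite !E exchange_big /=; apply: eq_bigr => i _.
by apply: eq_bigr => j _; rewrite mulrC.
Qed.

Lemma ltraceD f g : ltrace (f + g) = ltrace f + ltrace g.
Proof.
by rewrite /ltrace -big_split; apply: eq_bigr => i _; rewrite add_lfunE linearD.
Qed.

Lemma ltraceZ k f : ltrace (k *: f) = k * ltrace f.
Proof.
by rewrite /ltrace mulr_sumr; apply: eq_bigr => i _; rewrite scale_lfunE linearZ.
Qed.

Lemma ltraceN f : ltrace (- f) = - ltrace f.
Proof. by rewrite -scaleN1r ltraceZ mulN1r. Qed.

Lemma ltrace0 : ltrace (0 : 'End(V)) = 0.
Proof. by rewrite -(scale0r 0) ltraceZ mul0r. Qed.

End Trace.

Section LieAlgebra.
Variables (R : realType) (V : vectType R) (br : V -> V -> V).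
Hypothesis lieV : is_lie_algebra br.

Lemma br_linear_l (k : R) X Y Z : br (k *: X + Y) Z = k *: br X Z + br Y Z.
Proof. by case: lieV. Qed.
Lemma br_linear_r (k : R) X Y Z : br X (k *: Y + Z) = k *: br X Y + br X Z.
Proof. by case: lieV. Qed.
Lemma brDl X Y Z : br (X + Y) Z = br X Z + br Y Z.
Proof. by rewrite -[X in LHS]scale1r br_linear_l scale1r. Qed.
Lemma brDr X Y Z : br X (Y + Z) = br X Y + br X Z.
Proof. by rewrite -[Y in LHS]scale1r br_linear_r scale1r. Qed.
Lemma br0l Z : br 0 Z = 0.
Proof. by apply: (@addrI _ (br 0 Z)); rewrite -brDl !addr0. Qed.
Lemma br0r Z : br Z 0 = 0.
Proof. by apply: (@addrI _ (br Z 0)); rewrite -brDr !addr0. Qed.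
Lemma brZl k X Y : br (k *: X) Y = k *: br X Y.
Proof. by rewrite -[k *: X]addr0 br_linear_l br0l addr0. Qed.
Lemma brZr k X Y : br X (k *: Y) = k *: br X Y.
Proof. by rewrite -[k *: Y]addr0 br_linear_r br0r addr0. Qed.
Lemma brNl X Y : br (- X) Y = - br X Y.
Proof. by rewrite -scaleN1r brZl scaleN1r. Qed.
Lemma brNr X Y : br X (- Y) = - br X Y.
Proof. by rewrite -scaleN1r brZr scaleN1r. Qed.
Lemma brC X Y : br X Y = - br Y X.
Proof.
have brxx Z : br Z Z = 0 by case: lieV.
apply/eqP; rewrite -addr_eq0; apply/eqP.
by have := brxx (X + Y); rewrite brDl !brDr !brxx add0r addr0.
Qed.
Lemma br_suml I (r : seq I) (F : I -> V) Y :
  br (\sum_(i <- r) F i) Y = \sum_(i <- r) br (F i) Y.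
Proof.
by elim/big_rec2 : _ => [|i _ x _ <-]; rewrite ?br0l ?brDl.
Qed.
Lemma br_sumr I (r : seq I) (F : I -> V) Y :
  br Y (\sum_(i <- r) F i) = \sum_(i <- r) br Y (F i).
Proof.
by elim/big_rec2 : _ => [|i _ x _ <-]; rewrite ?br0r ?brDr.
Qed.
Lemma br_derivation Z X Y : br Z (br X Y) = br (br Z X) Y + br X (br Z Y).
Proof.
case: lieV => _ _ _ jac; have := jac Z X Y.
rewrite (brC Y Z) (brC Y (br Z X)) brNr => /eqP.
by rewrite -addrA -opprD subr_eq0 addrC => /eqP.
Qed.

Lemma adE X Y : ad br X Y = br X Y.
Proof.
have lin : linear (br X) by move=> k u v; rewrite br_linear_r.
pose F : {linear V -> V} := HB.pack (br X) (GRing.isLinear.Build _ _ _ _ _ lin).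
by rewrite /ad -[br _]/(F : V -> V) lfunE.
Qed.

(** The Jacobi identity makes ad [X,Y] the commutator of ad X and ad Y; the rest is cyclicity of the
    trace. *)
Lemma killing_invariant X Y Z : killing br (br X Y) Z = killing br X (br Y Z).
Proof.
have adbr U W : ad br (br U W) = (ad br U \o ad br W)%VF - (ad br W \o ad br U)%VF.
  apply/lfunP => v; rewrite add_lfunE opp_lfunE !comp_lfunE !adE.
  by rewrite (br_derivation U W v) addrK.
rewrite /killing !adbr comp_lfunDl comp_lfunDr comp_lfunNl comp_lfunNr.
rewrite !ltraceD !ltraceN comp_lfunA; congr (_ - _).
by rewrite -comp_lfunA ltrace_compC comp_lfunA.
Qed.

Lemma killingZr k X Y : killing br X (k *: Y) = k * killing br X Y.
Proof.
rewrite /killing -ltraceZ; congr ltrace; apply/lfunP => v.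
by rewrite scale_lfunE !comp_lfunE !adE brZl brZr.
Qed.

End LieAlgebra.

(** * Root spaces and the Killing form *)

Section Chevalley.
Variables (R : realType) (V : vectType R) (br : V -> V -> V) (h : {vspace V}).
Variables (Xc : dualh h -> V) (Hc : dualh h -> hR h) (tau : 'End(V)).
Hypothesis chev : chevalley_system br Xc Hc tau.
Local Notation root := (@is_root R V br h).
Local Notation "<| a , b |>" := (@ip R V br h a b).
Implicit Types (a b g : dualh h) (H : hR h) (X Y : V).

Lemma chev_lie : is_lie_algebra br. Proof. by case: chev => -[]. Qed.
Let lieV := chev_lie.

Lemma br_cartan H1 H2 : br (vsval H1) (vsval H2) = 0.
Proof. by case: chev. Qed.

Lemma chev_roots : exists rs : seq (dualh h),
  [/\ uniq rs, forall a, root a <-> a \in rs,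
      free [seq Xc a | a <- rs],
      (h :&: span [seq Xc a | a <- rs] = 0)%VS
    & (h + span [seq Xc a | a <- rs] = fullv)%VS].
Proof. by case: chev. Qed.

Lemma Xc_rootspace a : root a -> in_rootspace br a (Xc a).
Proof. by case: chev => _ _ _ + _ => /[apply] -[]. Qed.

Lemma br_cartan_Xc a H : root a -> br (vsval H) (Xc a) = (a H : R) *: Xc a.
Proof. by move=> /Xc_rootspace. Qed.

Lemma root_Hc_int a b : root a -> root b -> (b (Hc a) : R) \is a Num.int.
Proof. by case: chev => _ _ _ + _ => /[apply] -[_ + _ _ _] => /[apply]. Qed.

Lemma br_XcN a : root a -> br (Xc a) (Xc (- a)) = - vsval (Hc a).
Proof. by case: chev => _ _ _ + _ => /[apply] -[]. Qed.

Lemma tau_inv : lie_inv br tau. Proof. by case: chev => _ _ _ _ []. Qed.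
Lemma tau_br X Y : tau (br X Y) = br (tau X) (tau Y).
Proof. by case: tau_inv => -[]. Qed.
Lemma tauK X : tau (tau X) = X. Proof. by case: tau_inv. Qed.
Lemma tau_cartan H : tau (vsval H) = - vsval H.
Proof. by case: chev => _ _ _ _ []. Qed.
Lemma tau_Xc a : root a -> tau (Xc a) = Xc (- a).
Proof. by case: chev => _ _ _ _ [_ _ +]; apply. Qed.

Lemma root_neq0 a : root a -> a != 0. Proof. by case. Qed.

Lemma lfun_neqP a b : a != b -> exists H, a H != b H.
Proof.
move=> ab; apply: contrapT => hno; move/negP: ab; apply; apply/eqP/lfunP => H.
by apply: contrapT => /eqP abH; apply: hno; exists H.
Qed.

Lemma span_map_sum rs Y : uniq rs -> Y \in span [seq Xc a | a <- rs] ->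
  exists c : dualh h -> R, Y = \sum_(g <- rs) c g *: Xc g.
Proof.
elim: rs Y => [|g rs ih] Y /=.
  by move=> _; rewrite span_nil memv0 => /eqP ->; exists (fun=> 0); rewrite big_nil.
move=> /andP[grs urs]; rewrite span_cons => /memv_addP[_ /vlineP[k ->] [Z Zs ->]].
have [c ->] := ih _ urs Zs.
exists (fun a => if a == g then k else c a); rewrite big_cons eqxx; congr (_ + _).
apply: eq_big_seq => a ars; case: eqP => // ag.
by move: grs; rewrite -ag ars.
Qed.

Lemma sum_Xc_span rs (c : dualh h -> R) :
  \sum_(g <- rs) c g *: Xc g \in span [seq Xc a | a <- rs].
Proof.
rewrite big_seq; apply: memv_suml => g grs; apply: memvZ.
by apply: memv_span; apply: map_f.
Qed.

Lemma free_map_sum0 rs (c : dualh h -> R) : free [seq Xc a | a <- rs] ->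
  \sum_(g <- rs) c g *: Xc g = 0 -> {in rs, forall g, c g = 0}.
Proof.
elim: rs => [|g rs ih] //=; rewrite free_cons big_cons => /andP[gs frs] e.
have cg : c g = 0.
  apply/eqP; apply/negP => /negP cg; move/negP: gs; apply.
  move/eqP: e; rewrite addr_eq0 => /eqP e.
  rewrite -[Xc g]scale1r -(mulVf cg) -scalerA e; apply: memvZ.
  by rewrite memvN; exact: sum_Xc_span.
move=> a; rewrite inE => /predU1P[-> //|]; apply: ih => //.
by move: e; rewrite cg scale0r add0r.
Qed.

Definition root_seq : seq (dualh h) := sval (cid chev_roots).
Local Notation rs := root_seq.

Lemma root_seq_uniq : uniq rs. Proof. by case: (svalP (cid chev_roots)). Qed.
Lemma root_seqP a : root a <-> a \in rs.
Proof. by case: (svalP (cid chev_roots)). Qed.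
Lemma root_seq_free : free [seq Xc a | a <- rs].
Proof. by case: (svalP (cid chev_roots)). Qed.
Lemma root_seq_cap : (h :&: span [seq Xc a | a <- rs] = 0)%VS.
Proof. by case: (svalP (cid chev_roots)). Qed.
Lemma root_seq_full : (h + span [seq Xc a | a <- rs] = fullv)%VS.
Proof. by case: (svalP (cid chev_roots)). Qed.

Lemma root_decomp X : exists H (c : dualh h -> R),
  X = vsval H + \sum_(g <- rs) c g *: Xc g.
Proof.
have := memvf X; rewrite -root_seq_full => /memv_addP[H hH [Y Yspan ->]].
have [c ->] := span_map_sum root_seq_uniq Yspan.
by exists (vsproj h H), c; rewrite vsprojK.
Qed.

Lemma root_decomp0 H (c : dualh h -> R) :
    vsval H + \sum_(g <- rs) c g *: Xc g = 0 ->
  H = 0 /\ {in rs, forall g, c g = 0}.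
Proof.
move=> /eqP; rewrite addr_eq0 => /eqP e.
have H0 : vsval H = 0.
  apply/eqP; rewrite -memv0 -root_seq_cap memv_cap subvsP e memvN; exact: sum_Xc_span.
split; first by apply: val_inj; rewrite /= H0.
apply: free_map_sum0; first exact: root_seq_free.
by apply/eqP; rewrite -oppr_eq0 -e H0.
Qed.

Lemma br_cartan_decomp H' H (c : dualh h -> R) :
  br (vsval H') (vsval H + \sum_(g <- rs) c g *: Xc g) =
  \sum_(g <- rs) (c g * (g H' : R)) *: Xc g.
Proof.
rewrite (brDr lieV) br_cartan add0r (br_sumr lieV).
apply: eq_big_seq => g /root_seqP rg.
by rewrite (brZr lieV) br_cartan_Xc // scalerA.
Qed.

(** Coefficients of [H', X] = a(H') X are compared in the root decomposition: the Cartan part dies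
    because [a] is nonzero, and the coefficient at g != a dies because some H' separates [g] from
    [a]. *)
Lemma rootspace_line a X : root a -> in_rootspace br a X ->
  exists k, X = k *: Xc a.
Proof.
move=> ra Xa; have [H [c XE]] := root_decomp X.
have key H' : - (a H' : R) *: H = 0 /\
    {in rs, forall g, c g * ((g H' : R) - (a H' : R)) = 0}.
  apply: root_decomp0.
  have /eqP := Xa H'; rewrite XE br_cartan_decomp -subr_eq0 scalerDr => /eqP e.
  rewrite -[RHS]e linearZ /= scaleNr opprD addrCA; congr (_ + _).
  rewrite scaler_sumr -sumrB; apply: eq_bigr => g _.
  by rewrite scalerA -scalerBl; congr (_ *: _); ring.
have H0 : H = 0.
  have [H' aH'] := lfun_neqP (root_neq0 ra); rewrite zero_lfunE in aH'.
  have [/eqP + _] := key H'; rewrite scaler_eq0 oppr_eq0.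
  by rewrite (negPf aH') => /eqP.
have c0 g : g \in rs -> g != a -> c g = 0.
  move=> grs /lfun_neqP[H' gaH']; have [_ /(_ g grs) /eqP] := key H'.
  by rewrite mulf_eq0 subr_eq0 (negPf gaH') orbF => /eqP.
exists (c a); rewrite XE H0 linear0 add0r.
rewrite (bigD1_seq a) //=; [|exact/root_seqP|exact: root_seq_uniq].
by rewrite big1_seq ?addr0 // => g /andP[ga grs]; rewrite c0 ?scale0r.
Qed.

Lemma Xc_neq0 a : root a -> Xc a != 0.
Proof.
move=> ra; have [_ [X [X0 Xa]]] := ra; have [k XE] := rootspace_line ra Xa.
by apply: contraNN X0 => /eqP X0; rewrite XE X0 scaler0.
Qed.

Lemma rootspace0 a X : a != 0 -> ~ root a -> in_rootspace br a X -> X = 0.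
Proof.
move=> a0 na Xa; apply/eqP; apply/negP => /negP X0; apply: na.
by split => //; exists X.
Qed.

Lemma rootspace_br a b X Y : in_rootspace br a X -> in_rootspace br b Y ->
  in_rootspace br (a + b) (br X Y).
Proof.
move=> Xa Yb H; rewrite (br_derivation lieV) Xa Yb (brZl lieV) (brZr lieV).
by rewrite -scalerDl add_lfunE.
Qed.

(** Since [tau] is -1 on the Cartan subalgebra, it carries the root space of [a] to that of
    [- a]. *)
Lemma is_rootN a : root a -> root (- a).
Proof.
move=> ra; split; first by rewrite oppr_eq0 root_neq0.
exists (tau (Xc a)); split.
  apply/negP => /eqP t0; have := Xc_neq0 ra.
  by rewrite -[Xc a]tauK t0 linear0 eqxx.
move=> H; rewrite -[br _ _]tauK tau_br tauK tau_cartan (brNl lieV) br_cartan_Xc //.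
by rewrite opp_lfunE -scaleNr linearZ.
Qed.

Lemma is_rootNE a : root (- a) <-> root a.
Proof. by split => /is_rootN //; rewrite opprK. Qed.

(** Such an element is central, hence in the radical of the Killing form. *)
Lemma cartan_ad0 H : (forall g, root g -> g H = 0) -> H = 0.
Proof.
move=> H0; have adH : ad br (vsval H) = 0.
  apply/lfunP => X; rewrite adE // zero_lfunE.
  have [H' [c ->]] := root_decomp X; rewrite br_cartan_decomp big1_seq // => g.
  by move=> /andP[_ /root_seqP rg]; rewrite H0 // mulr0 scale0r.
have [[_ nondeg] _ _ _ _] := chev.
apply: val_inj; apply: nondeg => Y.
by rewrite /killing adH comp_lfun0l ltrace0.
Qed.

(** In a basis of the Cartan subalgebra followed by the root vectors, ad H ad H' is diagonal, with
    eigenvalue 0 on the first block and g(H) g(H') on [Xc g]. Positive definiteness on the real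
    Cartan subalgebra follows. *)
Lemma killing_cartan H H' : killing br (vsval H) (vsval H') =
  \sum_(g <- rs) (g H : R) * (g H' : R).
Proof.
pose l := vbasis h ++ [seq Xc a | a <- rs].
have lb : basis_of fullv (in_tuple l).
  rewrite /basis_of /= span_cat (span_basis (vbasisP h)) root_seq_full eqxx /=.
  rewrite cat_free (basis_free (vbasisP h)) root_seq_free /=.
  by apply/directv_addP; rewrite (span_basis (vbasisP h)) root_seq_cap.
(* The list of diagonal entries, in the order of the basis [l]. *)
pose m := nseq (\dim h) 0 ++ [seq (g H : R) * (g H' : R) | g <- rs].
have sz : size m = size l by rewrite !size_cat size_nseq !size_map size_tuple.
rewrite /killing (ltrace_basis _ lb).
have E (i : 'I_(size l)) :
    (ad br (vsval H) \o ad br (vsval H'))%VF l`_i = m`_i *: l`_i.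
  rewrite comp_lfunE !adE // !nth_cat size_nseq size_tuple.
  case: ltnP => hi.
    rewrite nth_nseq hi scale0r.
    have vh : (vbasis h)`_i \in h by apply/vbasis_mem/mem_nth; rewrite size_tuple.
    by rewrite -(vsprojK vh) br_cartan (br0r lieV).
  have hi' : (i - \dim h < size rs)%N.
    have szl : size l = (\dim h + size rs)%N by rewrite size_cat size_tuple size_map.
    by have := ltn_ord i; lia.
  rewrite !(nth_map 0) //; set g := nth 0 rs _.
  have rg : root g by apply/root_seqP; apply: mem_nth.
  by rewrite br_cartan_Xc // (brZr lieV) br_cartan_Xc // scalerA mulrC.
under eq_bigr => i _ do rewrite E linearZ /= coord_free ?(basis_free lb) // eqxx mulr1.
rewrite -(big_mkord xpredT (fun i => m`_i)) -sz -(big_nth 0 xpredT id).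
rewrite big_cat big_map /= big1_seq ?add0r // => x /andP[_].
by rewrite mem_nseq => /andP[_ /eqP].
Qed.

Lemma killing_cartan_ge0 H : 0 <= killing br (vsval H) (vsval H).
Proof. by rewrite killing_cartan; apply: sumr_ge0 => g _; rewrite -expr2 sqr_ge0. Qed.

Lemma killing_cartan_eq0 H : killing br (vsval H) (vsval H) = 0 -> H = 0.
Proof.
rewrite killing_cartan => /eqP.
rewrite psumr_eq0 => [|g _]; last by rewrite -expr2 sqr_ge0.
move=> /allP H0; apply: cartan_ad0 => g /root_seqP /H0.
by rewrite -expr2 sqrf_eq0 => /eqP.
Qed.

(** * The inner product on the dual of the Cartan subalgebra *)

Local Notation hb := (hbasis h).
Local Notation dh := (\dim (fullv : {vspace hR h})).

Definition hsum (x : 'rV[R]_dh) : hR h := \sum_(i < dh) x 0 i *: tnth hb i.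

Lemma hsum_coord H : H = hsum (\row_i coord hb i H).
Proof.
rewrite {1}(coord_vbasis (memvf H)) /hsum; apply: eq_bigr => i _.
by rewrite mxE (tnth_nth 0).
Qed.

Lemma lfun_hsumE a x : (a (hsum x) : R) = \sum_(i < dh) x 0 i * (a (tnth hb i) : R).
Proof. by rewrite /hsum linear_sum; apply: eq_bigr => i _; rewrite linearZ. Qed.

Lemma lfun_hsum a x : (a (hsum x) : R) = (x *m (coordrow a)^T) 0 0.
Proof.
by rewrite lfun_hsumE mxE; apply: eq_bigr => i _; rewrite !mxE.
Qed.

Lemma killing_hsum x y : killing br (vsval (hsum x)) (vsval (hsum y)) =
  (x *m gram br h *m y^T) 0 0.
Proof.
rewrite killing_cartan mxE.
under [RHS]eq_bigr => j _ do rewrite mxE mulr_suml.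
under [LHS]eq_bigr => g _ do rewrite !lfun_hsumE mulr_sumr.
rewrite exchange_big /=; apply: eq_bigr => j _.
under [LHS]eq_bigr => g _ do rewrite mulr_suml.
rewrite exchange_big /=; apply: eq_bigr => i _.
rewrite !mxE killing_cartan mulr_sumr mulr_suml; apply: eq_bigr => g _.
by ring.
Qed.

Lemma hsum_eq0 x : hsum x = 0 -> x = 0.
Proof.
move=> x0; apply/rowP => i; rewrite mxE.
have := coord_sum_free (fun i => x 0 i) i
  (basis_free (vbasisP (fullv : {vspace hR h}))).
under eq_bigr => j _ do rewrite -(tnth_nth 0).
by rewrite -/(hsum x) x0 linear0.
Qed.

Lemma gram_unit : gram br h \in unitmx.
Proof.
rewrite -row_free_unit; apply: inj_row_free => x xG.
apply/hsum_eq0/killing_cartan_eq0.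
by rewrite killing_hsum xG mul0mx mxE.
Qed.

(** The Riesz representative t_a of [a] for the Killing form, as [killing_dualE] shows. It converts
    the matrix formula for [ip] into a value of the Killing form. *)
Definition killing_dual a : hR h := hsum (coordrow a *m invmx (gram br h)).

Lemma ip_killing_dual a b : <| a, b |> = (b (killing_dual a) : R).
Proof. by rewrite lfun_hsum. Qed.

Lemma killing_dualE a H : killing br (vsval (killing_dual a)) (vsval H) = (a H : R).
Proof.
rewrite (hsum_coord H) killing_hsum mulmxKV ?gram_unit // lfun_hsum.
by rewrite -[RHS]/((_ : 'M_1) 0 0) !mxE; apply: eq_bigr => i _; rewrite !mxE mulrC.
Qed.

Lemma ipE a b :
  <| a, b |> = killing br (vsval (killing_dual b)) (vsval (killing_dual a)).
Proof. by rewrite killing_dualE ip_killing_dual. Qed.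

Lemma ipC a b : <| a, b |> = <| b, a |>.
Proof.
by rewrite !ipE !killing_cartan; apply: eq_bigr => g _; rewrite mulrC.
Qed.

Lemma ipDr a b g : <| a, b + g |> = <| a, b |> + <| a, g |>.
Proof. by rewrite !ip_killing_dual add_lfunE. Qed.
Lemma ipNr a b : <| a, - b |> = - <| a, b |>.
Proof. by rewrite !ip_killing_dual opp_lfunE. Qed.
Lemma ipZr k a b : <| a, k *: b |> = k * <| a, b |>.
Proof. by rewrite !ip_killing_dual scale_lfunE. Qed.
Lemma ipDl a b g : <| b + g, a |> = <| b, a |> + <| g, a |>.
Proof. by rewrite ipC ipDr !(ipC a). Qed.
Lemma ipNl a b : <| - b, a |> = - <| b, a |>.
Proof. by rewrite ipC ipNr (ipC a). Qed.
Lemma ipZl k a b : <| k *: b, a |> = k * <| b, a |>.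
Proof. by rewrite ipC ipZr (ipC a). Qed.

Lemma ip_ge0 a : 0 <= <| a, a |>.
Proof. by rewrite ipE killing_cartan_ge0. Qed.

Lemma ip_eq0 a : <| a, a |> = 0 -> a = 0.
Proof.
rewrite ipE => /killing_cartan_eq0 t0; apply/lfunP => H.
rewrite zero_lfunE -[LHS]killing_dualE t0 killing_cartan big1 // => g _.
by rewrite linear0 mul0r.
Qed.

Lemma ip_gt0 a : a != 0 -> 0 < <| a, a |>.
Proof.
move=> a0; rewrite lt_neqAle ip_ge0 andbT eq_sym.
by apply: contraNN a0 => /eqP /ip_eq0 ->.
Qed.

Lemma root_Hc_self a : root a -> (a (Hc a) : R) = 2.
Proof.
move=> ra; have [_ _ _ /(_ a ra)[_ _ _ e _] _] := chev.
move: e; rewrite br_cartan_Xc // => /eqP; rewrite -subr_eq0 -scalerBl scaler_eq0.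
by rewrite (negPf (Xc_neq0 ra)) orbF subr_eq0 => /eqP.
Qed.

(** Identifies [Hc a] with the usual coroot. Invariance of the Killing form applied to [X_a, X_(-a)]
    makes it a multiple of t_a, and a(H_a) = 2 fixes the factor. *)
Lemma Hc_killing_dual a : root a -> Hc a = (2 / <| a, a |>) *: killing_dual a.
Proof.
move=> ra.
pose k := killing br (Xc a) (Xc (- a)).
have HcE : Hc a = (- k) *: killing_dual a.
  have e H : killing br (vsval (Hc a)) (vsval H) = - k * (a H : R).
    rewrite -[vsval (Hc a)]opprK -br_XcN //.
    have -> X Y : killing br (- X) Y = - killing br X Y.
      rewrite /killing -ltraceN; congr ltrace; apply/lfunP => v.
      by rewrite opp_lfunE !comp_lfunE !adE // (brNl lieV).
    rewrite killing_invariant // (brC lieV) br_cartan_Xc; last exact: is_rootN.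
    rewrite opp_lfunE scaleNr opprK killingZr // mulNr; congr (- _).
    by rewrite mulrC.
  apply/eqP; rewrite -subr_eq0; apply/eqP/killing_cartan_eq0.
  set D := Hc a - _.
  have eD H : killing br (vsval D) (vsval H) = 0.
    rewrite killing_cartan.
    under eq_bigr => g _ do rewrite /D linearB linearZ /= mulrBl -scalerAl.
    rewrite sumrB -scaler_sumr -!killing_cartan e killing_dualE.
    by rewrite [_ *: _]/(_ * _) subrr.
  exact: eD.
have := root_Hc_self ra; rewrite {1}HcE linearZ /= -ip_killing_dual => e.
rewrite HcE; congr (_ *: _); rewrite -e [_ *: _]/(_ * _) mulfK //.
by rewrite gt_eqF // ip_gt0 // root_neq0.
Qed.

Lemma root_HcE a b : root a -> (b (Hc a) : R) = 2 * <| a, b |> / <| a, a |>.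
Proof.
move=> ra; rewrite Hc_killing_dual // linearZ /= -ip_killing_dual.
by rewrite /GRing.scale /= mulrAC.
Qed.

End Chevalley.

(** * Cayley generators and reflections *)

Section Roots.
Variables (R : realType) (V : vectType R) (br : V -> V -> V) (h : {vspace V}).
Variables (Xc : dualh h -> V) (Hc : dualh h -> hR h) (tau : 'End(V)).
Hypothesis chev : chevalley_system br Xc Hc tau.
Local Notation root := (@is_root R V br h).
Local Notation "<| a , b |>" := (@ip R V br h a b).
Implicit Types (a b g : dualh h) (H : hR h) (X Y : V) (M : seq (dualh h)).
Let lieV := chev_lie chev.

Lemma dualhZ k a H : (a (k *: H) : R) = k * (a H : R).
Proof. exact: linearZ. Qed.

Lemma dualhB a H1 H2 : (a (H1 - H2) : R) = (a H1 : R) - (a H2 : R).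
Proof. exact: linearB. Qed.

Lemma dualh_sum (r : seq (dualh h)) (F : dualh h -> hR h) a :
  (a (\sum_(b <- r) F b) : R) = \sum_(b <- r) (a (F b) : R).
Proof. exact: linear_sum. Qed.

(** A form of strong orthogonality that is stable under changing the sign of either root;
    [sorth_strongly] leads back to [strongly_orth]. *)
Definition sorth a b := [/\ <| a, b |> = 0, ~ root (a + b) & ~ root (a - b)].

Lemma br_Xc_cartan a H : root a -> br (Xc a) (vsval H) = - (a H : R) *: Xc a.
Proof. by move=> ra; rewrite (brC lieV) (br_cartan_Xc chev) // scaleNr. Qed.

Lemma br_Xc_nonroot a b : root a -> root b -> a + b != 0 -> ~ root (a + b) ->
  br (Xc a) (Xc b) = 0.
Proof.
move=> ra rb ab0 nab; apply: (rootspace0 ab0 nab).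
exact: (rootspace_br chev (Xc_rootspace chev ra) (Xc_rootspace chev rb)).
Qed.

Lemma br_Xc_root a b g : root a -> root b -> root g -> a + b = g ->
  exists k, br (Xc a) (Xc b) = k *: Xc g.
Proof.
move=> ra rb rg abg; apply: (rootspace_line chev rg); rewrite -abg.
exact: (rootspace_br chev (Xc_rootspace chev ra) (Xc_rootspace chev rb)).
Qed.

Lemma br_XNc a : root a -> br (Xc (- a)) (Xc a) = vsval (Hc a).
Proof. by move=> ra; rewrite (brC lieV) (br_XcN chev) // opprK. Qed.

Lemma ip_root_gt0 a : root a -> 0 < <| a, a |>.
Proof. by move=> /root_neq0; exact: (ip_gt0 chev). Qed.

Lemma orth_add_neq0 a b : root a -> <| a, b |> = 0 -> a + b != 0.
Proof.
move=> /ip_root_gt0 a0 ab; apply/negP; rewrite addr_eq0 => /eqP aE.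
have := a0; rewrite {2}aE ipNr ab oppr0 ltxx //.
Qed.

Lemma sorthNr a b : sorth a b -> sorth a (- b).
Proof. by case=> ab nD nB; split; rewrite ?ipNr ?ab ?oppr0 ?opprK. Qed.

Lemma sorthC a b : sorth a b -> sorth b a.
Proof.
case=> ab nD nB; split; [by rewrite (ipC chev)|by rewrite addrC|].
by rewrite -opprB => /(is_rootNE chev).
Qed.

Lemma sorthNl a b : sorth a b -> sorth (- a) b.
Proof. by move=> /sorthC/sorthNr/sorthC. Qed.

Lemma sorth_br a b : root a -> root b -> sorth a b -> br (Xc a) (Xc b) = 0.
Proof.
by move=> ra rb [ab nab _]; apply: br_Xc_nonroot => //; exact: orth_add_neq0.
Qed.

Definition cayley_gen M : 'End(V) := ad br (\sum_(b <- M) (Xc b + Xc (- b))).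
Local Notation cay := cayley_gen.
Definition so_roots M := [/\ uniq M, {in M, forall b, root b}
  & {in M &, forall a b, a != b -> sorth a b}].

Lemma cayley_genE M X : cay M X = \sum_(b <- M) (br (Xc b) X + br (Xc (- b)) X).
Proof.
rewrite /cay adE // (br_suml lieV).
by apply: eq_bigr => b _; rewrite (brDl lieV).
Qed.

Lemma cayley_gen_br M X Y : cay M (br X Y) = br (cay M X) Y + br X (cay M Y).
Proof. by rewrite !(adE lieV) (br_derivation lieV). Qed.

Lemma expop_cayley_gen_br M t X Y :
  expop (cay M) t (br X Y) = br (expop (cay M) t X) (expop (cay M) t Y).
Proof.
apply: expop_morph => [*|*|]; [exact: br_linear_l|exact: br_linear_r|].
exact: cayley_gen_br.
Qed.

Lemma cayley_gen_cartan M H : {in M, forall b, root b} ->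
  cay M (vsval H) = - \sum_(b <- M) (b H : R) *: (Xc b - Xc (- b)).
Proof.
move=> rM; rewrite cayley_genE -sumrN; apply: eq_big_seq => b /rM rb.
have rNb := is_rootN chev rb; rewrite !br_Xc_cartan //.
by rewrite opp_lfunE opprK scalerBr opprB scaleNr addrC.
Qed.

Lemma so_Hc M a b : so_roots M -> a \in M -> b \in M -> a != b ->
  (a (Hc b) : R) = 0.
Proof.
case=> _ rM so aM bM ab; rewrite (root_HcE chev a (rM _ bM)).
by have [-> _ _] := so _ _ bM aM (contra_neq esym ab); rewrite mulr0 mul0r.
Qed.

(** Strong orthogonality removes all terms from the other roots. In the sl_2 of [b] the generator
    sends H_b to -2 (X_b - X_(-b)), and X_b - X_(-b) to 2 H_b. *)
Lemma cayley_gen_Hc M b : so_roots M -> b \in M ->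
  cay M (cay M (vsval (Hc b))) = - (4%:R *: vsval (Hc b)).
Proof.
move=> soM bM; have [uM rM so] := soM; have rb := rM _ bM.
have rNb := is_rootN chev rb.
rewrite cayley_gen_cartan // (bigD1_seq b) //= (root_Hc_self chev) //.
rewrite big1_seq ?addr0; last first.
  by move=> a /andP[ab aM]; rewrite (so_Hc soM) // scale0r.
rewrite linearN linearZ /= cayley_genE (bigD1_seq b) //= big1_seq ?addr0; last first.
  move=> a /andP[ab aM]; have ra := rM _ aM; have rNa := is_rootN chev ra.
  have sab := so _ _ aM bM ab.
  rewrite !(brDr lieV) !(brNr lieV) !sorth_br ?oppr0 ?addr0 //;
    do ?[exact: sorthNr | exact: sorthNl | exact/sorthNl/sorthNr].
rewrite !(brDr lieV) !(brNr lieV) (br_XcN chev) // br_XNc // opprK.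
have -> : br (Xc b) (Xc b) = 0 by case: lieV.
have -> : br (Xc (- b)) (Xc (- b)) = 0 by case: lieV.
by rewrite add0r oppr0 addr0 scalerDr -scalerDl; congr (- (_ *: _)); ring.
Qed.

Local Notation quarter M := (expop (cay M) (pi / 4)).

(** The product of the reflections in the roots of [M]: the generator kills [H - H1], where every
    [b] in [M] vanishes, while the squared quarter turn is -1 on the coroot part [H1]. *)
Lemma quarter2_cartan M H : so_roots M ->
  quarter M (quarter M (vsval H)) =
  vsval (H - \sum_(b <- M) (b H : R) *: Hc b).
Proof.
move=> soM; have [uM rM so] := soM.
(* The projection of [H] to the span of the coroots of [M]; the half compensates b(H_b) = 2. *)
pose H1 := \sum_(b <- M) (b H / 2 : R) *: Hc b.
have H1E a : a \in M -> a H1 = a H.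
  move=> aM; rewrite /H1 dualh_sum (bigD1_seq a) //= dualhZ.
  rewrite (root_Hc_self chev (rM _ aM)) big1_seq ?addr0 ?divfK ?pnatr_eq0 //.
  by move=> b /andP[ba bM]; rewrite dualhZ (so_Hc soM) ?mulr0 // eq_sym.
have fixH : cay M (vsval (H - H1)) = 0.
  rewrite cayley_gen_cartan // big1_seq ?oppr0 // => b /andP[_ bM].
  by rewrite dualhB H1E // subrr scale0r.
have negH : quarter M (quarter M (vsval H1)) = - vsval H1.
  rewrite expop_quarter_turn // /H1 !linear_sum /= -?sumrN.
  apply: eq_big_seq => b bM.
  by rewrite !linearZ /= cayley_gen_Hc // !(scalerN, scalerA); congr (- (_ *: _)); ring.
have -> : quarter M (quarter M (vsval H)) =
    quarter M (quarter M (vsval (H - H1) + vsval H1)) by rewrite -linearD subrK.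
rewrite [in LHS]linearD [in LHS]linearD /= negH.
rewrite !expop_ker //.
have -> : vsval (H - H1) - vsval H1 = vsval (H - H1 - H1) by rewrite [RHS]linearB.
rewrite -[RHS](linearB (vsval : subvs_of h -> V)); congr (vsval _).
rewrite -addrA -opprD; congr (_ - _).
rewrite /H1 -big_split /=; apply: eq_bigr => b _.
by rewrite -scalerDl -splitr.
Qed.

Lemma so_roots1 b : root b -> so_roots [:: b].
Proof.
move=> rb; split=> // [a|a1 a2]; rewrite ?inE => /eqP -> //.
by move=> /eqP ->; rewrite eqxx.
Qed.

(** For M = {b} the squared quarter turn is an automorphism acting on the Cartan subalgebra as the
    reflection in [b], so it carries X_a to a root vector for the reflected root. No root strings
    are needed. *)
Lemma root_reflection a b : root a -> root b ->
  root (a - (a (Hc b) : R) *: b).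
Proof.
move=> ra rb; split.
  apply/negP; rewrite subr_eq0 => /eqP aE.
  have := congr1 (fun f : dualh h => f (Hc b) : R) aE.
  rewrite scale_lfunE (root_Hc_self chev rb) /GRing.scale /= => e.
  have a0 : (a (Hc b) : R) = 0 by lra.
  by move/negP: (root_neq0 ra); apply; rewrite aE a0 scale0r.
exists (quarter [:: b] (quarter [:: b] (Xc a))); split.
  apply/negP => /eqP x0; have := Xc_neq0 chev ra.
  rewrite -(expopNK (cay [:: b]) (pi / 4) (Xc a)).
  rewrite -(expopNK (cay [:: b]) (pi / 4) (quarter _ (Xc a))) x0.
  by rewrite !linear0 eqxx.
move=> H.
have nE H' := quarter2_cartan H' (so_roots1 rb).
pose n H' := H' - (b H' : R) *: Hc b.
(* The reflection [n] is an involution, so every [H] is the image of [n H], and the automorphism can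
   be pulled out of the bracket. *)
have HE : H = n (n H).
  rewrite {1}/n /n dualhB dualhZ (root_Hc_self chev rb).
  rewrite -addrA -opprD -scalerDl.
  have -> : (b H : R) + ((b H : R) - (b H : R) * 2) = 0 by ring.
  by rewrite scale0r subr0.
have -> : vsval H = quarter [:: b] (quarter [:: b] (vsval (n H))).
  by rewrite nE big_seq1 -/(n (n H)) -HE.
rewrite -!expop_cayley_gen_br (br_cartan_Xc chev) // !linearZ /=; congr (_ *: _).
rewrite dualhB dualhZ add_lfunE scale_lfunE opp_lfunE scalerN.
by congr (_ - _); exact: mulrC.
Qed.

(** * Orthogonal roots whose sum is a root *)

Section OrthogonalPair.
Variables a b : dualh h.
Hypotheses (ra : root a) (rb : root b) (oab : <| a, b |> = 0) (rab : root (a + b)).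

Let oba : <| b, a |> = 0. Proof. by rewrite (ipC chev). Qed.

(** The Cartan integer of [a] against [a + b] is 2|a|^2 / (|a|^2 + |b|^2), strictly between 0 and 2,
    hence 1. *)
Lemma orth_pair_norm : <| a, a |> = <| b, b |>.
Proof.
have a0 := ip_root_gt0 ra; have b0 := ip_root_gt0 rb.
have n0 : <| a + b, a + b |> = <| a, a |> + <| b, b |>.
  by rewrite !(ipDl chev) !ipDr oab oba; ring.
have := root_Hc_int chev rab ra.
rewrite (root_HcE chev a rab) (ipDl chev) oba addr0 n0 => /intrP[m mE].
have s0 : 0 < <| a, a |> + <| b, b |> by lra.
have e : 2 * <| a, a |> = m%:~R * (<| a, a |> + <| b, b |>).
  by rewrite -mE divfK // gt_eqF.
have m1 : m = 1.
  have m_gt0 : (0 : R) < m%:~R by nra.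
  have m_lt2 : m%:~R < (2 : R) by nra.
  have m_gt0' : 0 < m by rewrite -(@ltr_int R).
  have m_lt2' : m < 2 by rewrite -(@ltr_int R).
  by lia.
by move: e; rewrite m1 => e; lra.
Qed.

Lemma orth_pair_sub : root (a - b).
Proof.
have := root_reflection rab rb; rewrite add_lfunE (root_Hc_self chev rb).
rewrite (root_HcE chev a rb) oba mulr0 mul0r add0r.
by rewrite scaler_nat mulr2n opprD addrA addrK.
Qed.

End OrthogonalPair.

(** The Cartan integer of [b] against a + 2b would be 4/5. *)
Lemma orth_pair_add2 a b : root a -> root b -> <| a, b |> = 0 ->
  root (a + b) -> ~ root (a + b + b).
Proof.
move=> ra rb oab rab r2; have nab := orth_pair_norm ra rb oab rab.
have b0 := ip_root_gt0 rb.
have := root_Hc_int chev r2 rb; rewrite (root_HcE chev b r2).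
rewrite !(ipDl chev) !ipDr oab (ipC chev b a) oab nab => int45.
apply: (no_int_between (k := 0) int45).
  by rewrite mulr0z divr_gt0 //; lra.
by rewrite add0r ltr_pdivrMr; lra.
Qed.

(** The [b]-string through [a] is a - b, a, a + b, so the sl_2 of [b] acts as in its
    three-dimensional representation, with X_a of weight 0. *)
Lemma orth_pair_br a b : root a -> root b -> <| a, b |> = 0 -> root (a + b) ->
  let p := br (Xc b) (Xc a) in let q := br (Xc (- b)) (Xc a) in
  [/\ br (Xc b) p = 0, br (Xc (- b)) q = 0,
      br (Xc (- b)) p = - (2%:R *: Xc a) & br (Xc b) q = - (2%:R *: Xc a)].
Proof.
move=> ra rb oab rab p q.
have rNb := is_rootN chev rb; have rmab := orth_pair_sub rb oab rab.
have b0 := ip_root_gt0 rb.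
have oba : <| b, a |> = 0 by rewrite (ipC chev).
have oaNb : <| a, - b |> = 0 by rewrite ipNr oab oppr0.
have aHb : (a (Hc b) : R) = 0 by rewrite (root_HcE chev a rb) oba mulr0 mul0r.
have ebp : br (Xc b) p = 0.
  apply: (@rootspace0 _ _ _ _ (b + (b + a))).
  - apply/negP => /eqP e; have := b0; have : <| b, b + (b + a) |> = 0.
      by rewrite e -(scale0r b) ipZr mul0r.
    by rewrite !ipDr oba; lra.
  - have -> : b + (b + a) = a + b + b by rewrite [LHS]addrC [b + a]addrC.
    exact: (orth_pair_add2 ra rb oab rab).
  - apply: (rootspace_br chev (Xc_rootspace chev rb)).
    exact: (rootspace_br chev (Xc_rootspace chev rb) (Xc_rootspace chev ra)).
have n2 : ~ root (a - b - b) by exact: (orth_pair_add2 ra rNb oaNb rmab).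
have ab20 : - b + (a - b) != 0.
  apply/negP => /eqP e; have := b0; have : <| b, - b + (a - b) |> = 0.
    by rewrite e -(scale0r b) ipZr mul0r.
  by rewrite !ipDr !ipNr oba; lra.
have fY : br (Xc (- b)) (Xc (a - b)) = 0.
  by apply: br_Xc_nonroot => //; rewrite addrC.
have HY : br (vsval (Hc b)) (Xc (a - b)) = - (2%:R *: Xc (a - b)).
  rewrite (br_cartan_Xc chev) // add_lfunE opp_lfunE aHb (root_Hc_self chev rb).
  by rewrite add0r scaleNr.
have [k kE] : exists k, br (Xc b) (Xc (a - b)) = k *: Xc a.
  by apply: br_Xc_root => //; rewrite addrC subrK.
(* X_(-b) kills the lowest vector X_(a-b), so [X_(-b), [X_b, X_(a-b)]] is H_b acting with weight -2.
   This forces [k] to be nonzero. *)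
have e1 : k *: q = - (2%:R *: Xc (a - b)).
  rewrite /q -(brZr lieV) -kE (br_derivation lieV) fY (br0r lieV) addr0.
  by rewrite br_XNc.
have k0 : k != 0.
  apply/negP => /eqP k0; move: e1; rewrite k0 scale0r => /eqP.
  rewrite eq_sym oppr_eq0 scaler_eq0 (negPf (Xc_neq0 chev rmab)) orbF.
  by rewrite pnatr_eq0.
have qE : q = (- 2%:R / k) *: Xc (a - b).
  by rewrite mulrC -scalerA scaleNr -e1 scalerA mulVf ?scale1r.
have ebq : br (Xc b) q = - (2%:R *: Xc a).
  by rewrite qE (brZr lieV) kE scalerA divfK // scaleNr.
split=> //; first by rewrite qE (brZr lieV) fY scaler0.
rewrite /p (br_derivation lieV) br_XNc // -/q ebq.
by rewrite (br_cartan_Xc chev) // aHb scale0r add0r.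
Qed.

Lemma orth_pair_br_neq0 a b : root a -> root b -> <| a, b |> = 0 ->
  root (a + b) -> br (Xc b) (Xc a) != 0.
Proof.
move=> ra rb oab rab; have [_ _ + _] := orth_pair_br ra rb oab rab.
apply: contra_eq_neq => ->; rewrite (br0r lieV) eq_sym oppr_eq0 scaler_eq0.
by rewrite pnatr_eq0 (negPf (Xc_neq0 chev ra)).
Qed.

(** All lengths agree, so reflecting a + b1 in a + b2 just subtracts. Hence two strongly orthogonal
    roots cannot both form roots with [a]. *)
Lemma orth_triple a b1 b2 : root a -> root b1 -> root b2 ->
  <| a, b1 |> = 0 -> <| a, b2 |> = 0 -> <| b1, b2 |> = 0 ->
  root (a + b1) -> root (a + b2) -> root (b1 - b2).
Proof.
move=> ra r1 r2 o1 o2 o12 ra1 ra2.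
have n2 := orth_pair_norm ra r2 o2 ra2; have a0 := ip_root_gt0 ra.
have := root_reflection ra1 ra2; rewrite (root_HcE chev _ ra2).
rewrite !(ipDl chev) !ipDr o1 (ipC chev b2 a) (ipC chev b2 b1) o12 o2 -n2.
rewrite (_ : 2 * _ / _ = 1); last first.
  by field; apply: lt0r_neq0; lra.
by rewrite scale1r opprD addrACA subrr add0r.
Qed.

(** Otherwise |g|^2 = |a + b|^2 = 2|a|^2, and the Cartan integer of [a] against a + b + g would be
    1/2. *)
Lemma orth_triple_add a b g : root a -> root b -> root g ->
  <| a, b |> = 0 -> <| a, g |> = 0 -> <| b, g |> = 0 ->
  root (a + b) -> ~ root (a + b + g).
Proof.
move=> ra rb rg oab oag obg rab rabg.
have nab := orth_pair_norm ra rb oab rab; have a0 := ip_root_gt0 ra.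
have oabg : <| a + b, g |> = 0 by rewrite (ipDl chev) oag obg addr0.
have ng := orth_pair_norm rab rg oabg rabg.
move: ng; rewrite !(ipDl chev) !ipDr oab (ipC chev b a) oab -nab => ng.
have := root_Hc_int chev rabg ra; rewrite (root_HcE chev _ rabg).
rewrite !(ipDl chev) !ipDr (ipC chev b a) (ipC chev g a) (ipC chev g b).
rewrite oab oag obg -nab -ng => int12.
apply: (no_int_between (k := 0) int12).
  by rewrite mulr0z divr_gt0 //; lra.
by rewrite add0r ltr_pdivrMr; lra.
Qed.

Lemma orth_pair_sorth a b g : root a -> root b -> root g ->
  <| a, b |> = 0 -> <| a, g |> = 0 -> <| b, g |> = 0 ->
  root (a + b) -> sorth (a + b) g /\ sorth (a - b) g.
Proof.
move=> ra rb rg oab oag obg rab.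
have rNb := is_rootN chev rb; have rNg := is_rootN chev rg.
have rmab := orth_pair_sub rb oab rab.
have oaNb : <| a, - b |> = 0 by rewrite ipNr oab oppr0.
have oaNg : <| a, - g |> = 0 by rewrite ipNr oag oppr0.
have obNg : <| b, - g |> = 0 by rewrite ipNr obg oppr0.
have oNbg : <| - b, g |> = 0 by rewrite (ipNl chev) obg oppr0.
have oNbNg : <| - b, - g |> = 0 by rewrite ipNr oNbg oppr0.
split; split.
- by rewrite (ipDl chev) oag obg addr0.
- exact: (orth_triple_add ra rb rg oab oag obg rab).
- exact: (orth_triple_add ra rb rNg oab oaNg obNg rab).
- by rewrite (ipDl chev) oag oNbg addr0.
- exact: (orth_triple_add ra rNb rg oaNb oag oNbg rmab).
- exact: (orth_triple_add ra rNb rNg oaNb oaNg oNbNg rmab).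
Qed.

(** First, 3a is not a root, since it would give the Cartan integer 2/3; so X_a kills X_(2a). As
    [X_(-a), X_(2a)] is a multiple of X_a, the Jacobi identity then makes H_a kill X_(2a), where it
    acts by 4. *)
Lemma root_double a : root a -> ~ root (a + a).
Proof.
move=> ra r2; have a0 := ip_root_gt0 ra.
have n3 : ~ root (a + (a + a)).
  move=> r3; have := root_Hc_int chev r3 ra; rewrite (root_HcE chev _ r3).
  rewrite !(ipDl chev) !ipDr => int23; apply: (no_int_between (k := 0) int23).
    by rewrite mulr0z divr_gt0 //; lra.
  by rewrite add0r ltr_pdivrMr; lra.
have a30 : a + (a + a) != 0.
  apply/negP => /eqP e; have : <| a, a + (a + a) |> = 0.
    by rewrite e -(scale0r a) ipZr mul0r.
  by rewrite !ipDr; lra.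
have rNa := is_rootN chev ra.
have [k kE] : exists k, br (Xc (- a)) (Xc (a + a)) = k *: Xc a.
  by apply: br_Xc_root => //; rewrite addKr.
have := br_derivation lieV (Xc a) (Xc (- a)) (Xc (a + a)).
rewrite kE (brZr lieV) [br (Xc a) (Xc (a + a))]br_Xc_nonroot // (br0r lieV) addr0.
have -> : br (Xc a) (Xc a) = 0 by case: lieV.
rewrite scaler0 (br_XcN chev) // (brNl lieV) (br_cartan_Xc chev) //.
rewrite add_lfunE (root_Hc_self chev ra) => /eqP; rewrite eq_sym oppr_eq0 scaler_eq0.
by rewrite (negPf (Xc_neq0 chev r2)) orbF => /eqP e; have : (2 + 2 : R) = 0 by []; lra.
Qed.

End Roots.

(** * Root lengths within an irreducible component *)

Section LongRoots.
Variables (R : realType) (V : vectType R) (br : V -> V -> V) (h : {vspace V}).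
Variables (Xc : dualh h -> V) (Hc : dualh h -> hR h) (tau : 'End(V)).
Hypothesis chev : chevalley_system br Xc Hc tau.
Local Notation root := (@is_root R V br h).
Local Notation "<| a , b |>" := (@ip R V br h a b).
Implicit Types (a b g : dualh h).

Lemma ip_CauchySchwarz a b : <| a, b |> ^+ 2 <= <| a, a |> * <| b, b |>.
Proof.
have [->|b0] := eqVneq b 0.
  by rewrite -(scale0r a) !ipZr !mul0r mulr0 expr0n.
have bp := ip_gt0 chev b0.
have := ip_ge0 chev (<| b, b |> *: a - <| a, b |> *: b).
rewrite !(ipDl chev, ipDr, ipNr, ipNl chev, ipZr, ipZl chev) (ipC chev b a).
set x := <| a, a |>; set y := <| b, b |> in bp *; set z := <| a, b |> => e.
rewrite -(ler_pM2l bp) -subr_ge0 (_ : _ - _ = y * (y * x) - y * (z * z)); last by ring.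
by move: e; nra.
Qed.

Lemma ip_reflection a b g : root b -> <| a - (a (Hc b) : R) *: b, g |> =
  <| a, g |> - 2 * <| b, a |> / <| b, b |> * <| b, g |>.
Proof.
by move=> rb; rewrite (ipDl chev) (ipNl chev) (ipZl chev) (root_HcE chev a rb).
Qed.

Lemma ip_reflection_norm a b : root b ->
  let a' := a - (a (Hc b) : R) *: b in <| a', a' |> = <| a, a |>.
Proof.
move=> rb a'; have b0 : <| b, b |> != 0 by rewrite gt_eqF // (ip_root_gt0 chev).
rewrite [LHS](ip_reflection _ _ rb) (ipC chev a) (ip_reflection _ _ rb).
rewrite (ipC chev b a') (ip_reflection _ _ rb) (ipC chev a b).
by field.
Qed.

(** Follows the chain from [a] to [g]: when the current root is orthogonal to the next member [y] of
    a link x, y, its reflection in [x] has the same length and is not. *)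
Lemma same_component_conj a g : root a -> same_component br a g ->
  exists a', [/\ root a', <| a', a' |> = <| a, a |> & <| a', g |> != 0].
Proof.
move=> ra ag; suff: forall x y, same_component br x y -> forall a', root a' ->
    <| a', x |> != 0 ->
    exists a2, [/\ root a2, <| a2, a2 |> = <| a', a' |> & <| a2, y |> != 0].
  by apply; [exact: ag|exact: ra|rewrite gt_eqF // (ip_root_gt0 chev)].
move=> x y; elim=> {x y} [x y [rx [ry xy]]|x|x y z _ ih1 _ ih2] a' ra' a'x.
- have [a'y|a'y] := eqVneq <| a', y |> 0; last by exists a'.
  exists (a' - (a' (Hc x) : R) *: x); split.
  + exact: (root_reflection chev).
  + exact: ip_reflection_norm.
  + have x0 := ip_root_gt0 chev rx.
    rewrite ip_reflection // a'y sub0r oppr_eq0 !mulf_neq0 ?invr_eq0 ?pnatr_eq0 //.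
    * by rewrite (ipC chev).
    * by rewrite gt_eqF.
    * exact/eqP.
- by exists a'.
- have [a2 [ra2 n2 a2y]] := ih1 _ ra' a'x.
  by have [a3 [ra3 n3 a3z]] := ih2 _ ra2 a2y; exists a3; split; rewrite // n3.
Qed.

Lemma same_component_conj_gt0 a g : root a -> same_component br a g ->
  exists a', [/\ root a', <| a', a' |> = <| a, a |> & 0 < <| a', g |>].
Proof.
move=> ra /(same_component_conj ra)[a' [ra' n']].
rewrite neq_lt => /orP[neg|pos]; last by exists a'.
exists (- a'); split; first exact: (is_rootN chev).
  by rewrite ipNr (ipNl chev) opprK.
by rewrite (ipNl chev) oppr_gt0.
Qed.

(** The Cartan integer of the shorter root against the longer one is positive, and below 2 by
    Cauchy-Schwarz. *)
Lemma long_short_ip a g : root a -> root g -> <| a, a |> < <| g, g |> ->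
  0 < <| a, g |> -> 2 * <| a, g |> = <| g, g |>.
Proof.
move=> ra rg lt_ag w0; have g0 := ip_root_gt0 chev rg.
have := root_Hc_int chev rg ra; rewrite (root_HcE chev a rg) (ipC chev g a).
move=> /intrP[m mE].
have e : 2 * <| a, g |> = m%:~R * <| g, g |> by rewrite -mE divfK // gt_eqF.
have m0 : 0 < m.
  by rewrite -(@ltr_int R) -(pmulr_lgt0 _ g0) -e; apply: mulr_gt0.
have m2 : m < 2.
  rewrite -(@ltr_int R) ltNge; apply/negP => m2.
  have wg : <| g, g |> <= <| a, g |>.
    by have := ler_wpM2r (ltW g0) m2; rewrite -e; lra.
  have := ip_CauchySchwarz a g; move: wg lt_ag g0.
  by set x := <| a, a |>; set y := <| g, g |>; set w := <| a, g |>; nra.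
have m1 : m = 1 by lia.
by rewrite e m1 mul1r.
Qed.

(** A longer root [g] of the component would have integral ratios p = |g|^2 / |a|^2 and q = |g|^2 /
    |a + b|^2 with p = 2q and 2 < p <= 4. Then p = 4 makes [g] twice a root, which is impossible. *)
Lemma long_orth_sum a b : root a -> root b -> <| a, b |> = 0 -> root (a + b) ->
  long_root br (a + b).
Proof.
move=> ra rb oab rab; split=> // g rg comp; rewrite leNgt; apply/negP => gt.
have nab := orth_pair_norm chev ra rb oab rab.
have n0 := ip_root_gt0 chev ra.
have nE : <| a + b, a + b |> = 2 * <| a, a |>.
  by rewrite !(ipDl chev, ipDr) (ipC chev b a) oab -nab; ring.
have acomp : same_component br a g.
  apply: rt_trans comp; apply: rt_step; split=> //; split=> //.
  by rewrite ipDr oab addr0; apply/eqP; rewrite gt_eqF.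
have [a1 [r1 n1 w1]] := same_component_conj_gt0 ra acomp.
have [d1 [rd1 nd1 wd1]] := same_component_conj_gt0 rab comp.
have wE : 2 * <| a1, g |> = <| g, g |>.
  by apply: long_short_ip => //; rewrite n1; lra.
have wdE : 2 * <| d1, g |> = <| g, g |> by apply: long_short_ip => //; rewrite nd1.
have := root_Hc_int chev r1 rg; rewrite (root_HcE chev _ r1) n1 wE => /intrP[p pE].
have := root_Hc_int chev rd1 rg.
rewrite (root_HcE chev _ rd1) nd1 nE wdE => /intrP[q qE].
have gp : <| g, g |> = p%:~R * <| a, a |> by rewrite -pE divfK // gt_eqF.
have gq : <| g, g |> = q%:~R * (2 * <| a, a |>) by rewrite -qE divfK // gt_eqF //; lra.
have pq : p = 2 * q.
  apply/eqP; rewrite -(eqr_int R) rmorphM /=; apply/eqP.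
  apply: (@mulIf _ <| a, a |>); first by rewrite gt_eqF.
  by rewrite -gp gq; ring.
have cs := ip_CauchySchwarz a1 g; rewrite n1 in cs.
have g0 := ip_root_gt0 chev rg.
have g4 : <| g, g |> <= 4 * <| a, a |>.
  by rewrite -(ler_pM2r g0); move: cs wE; set w := <| a1, g |>; nra.
have p2 : (2 : int) < p.
  rewrite -(@ltr_int R) -(ltr_pM2r n0) -gp -nE; exact: gt.
have p4 : p <= 4.
  by rewrite -(@ler_int R) -(ler_pM2r n0) -gp.
have p4' : p = 4 by lia.
(* With p = 4 equality holds in Cauchy-Schwarz, and |g - 2 a1|^2 = 0. *)
have gE : g = a1 + a1.
  apply/eqP; rewrite -subr_eq0; apply/eqP/(ip_eq0 chev).
  rewrite !(ipDl chev, ipDr, ipNr, ipNl chev) (ipC chev g a1) n1.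
  by move: gp wE; rewrite p4'; lra.
by apply: (root_double chev r1); rewrite -gE.
Qed.

End LongRoots.

(** * Involutions and their Cayley transforms *)

Section Involution.
Variables (R : realType) (V : vectType R) (br : V -> V -> V) (h : {vspace V}).
Variables (Xc : dualh h -> V) (Hc : dualh h -> hR h) (tau : 'End(V)).
Hypothesis chev : chevalley_system br Xc Hc tau.
Variable f : 'End(V).
Hypothesis invf : in_Inv_tau br h tau f.
Local Notation root := (@is_root R V br h).
Implicit Types (a b g : dualh h) (H : hR h) (X Y : V).
Let lieV := chev_lie chev.

Lemma inv_br X Y : f (br X Y) = br (f X) (f Y).
Proof. by case: invf => -[] []. Qed.

Lemma invK X : f (f X) = X. Proof. by case: invf => -[]. Qed.

(** The compact form contains X + tau X and i (X - tau X). Since its image stays in it, [f] sends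
    the first into the +1 and X - tau X into the -1 eigenspace of [tau]. *)
Lemma inv_tau X : f (tau X) = tau (f X).
Proof.
case: invf => _ _ gf _.
have [/= e1 _] : gform tau (antiext f (X + tau X, 0)).
  by apply: gf; split; rewrite /= ?linear0 ?oppr0 // linearD /= (tauK chev) addrC.
have [/= _ e2] : gform tau (antiext f (0, X - tau X)).
  by apply: gf; split; rewrite /= ?linear0 // linearB /= (tauK chev) opprB.
move: e1 e2; rewrite opprK (raddfN tau) (raddfB f) (raddfB tau) (raddfD f) (raddfD tau).
set P := f X; set Q := f (tau X) => e1 e2.
have : 2%:R *: Q = 2%:R *: tau P; last by move=> /scalerI; apply; rewrite pnatr_eq0.
rewrite !scaler_nat !mulr2n.
transitivity ((P + Q) - (P - Q)).
  by rewrite opprB addrACA [P + _]addrC addrACA subrr addr0.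
by rewrite -e1 -e2 opprK addrACA subrr addr0.
Qed.

Definition inv_cartan H : hR h := vsproj h (f (vsval H)).

Lemma inv_cartanE H : vsval (inv_cartan H) = f (vsval H).
Proof.
rewrite /inv_cartan vsprojK //; case: invf => _ hf _ _.
by have := memv_img f (subvsP H); rewrite hf.
Qed.

Lemma inv_cartanK H : inv_cartan (inv_cartan H) = H.
Proof. by apply: val_inj; rewrite /= !inv_cartanE invK. Qed.

Lemma rhoE a H : rho f a H = a (inv_cartan H).
Proof.
have lin : linear (fun H : hR h => (a (vsproj h ((f^-1)%VF (vsval H))) : R^o)).
  by move=> k u v; rewrite !linearP.
pose F : {linear hR h -> R^o} := HB.pack (fun H : hR h =>
  (a (vsproj h ((f^-1)%VF (vsval H))) : R^o)) (GRing.isLinear.Build _ _ _ _ _ lin).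
rewrite /rho -[X in linfun X]/(F : hR h -> R^o) lfunE /= /inv_cartan.
have kf : lker f == 0%VS by apply/lker0P => x y e; rewrite -(invK x) e invK.
by rewrite -[X in (f^-1)%VF X]invK (lker0_lfunK kf).
Qed.

Lemma imag_rootP a :
  imag_root br (rho f) a <-> root a /\ forall H, a (inv_cartan H) = - a H.
Proof.
split=> -[ra e]; split=> //.
  by move=> H; rewrite -rhoE e opp_lfunE.
by apply/lfunP => H; rewrite rhoE e opp_lfunE.
Qed.

Lemma imag_rootN a : imag_root br (rho f) a -> imag_root br (rho f) (- a).
Proof.
move=> /imag_rootP[ra e]; apply/imag_rootP; split; first exact: (is_rootN chev).
by move=> H; rewrite !opp_lfunE e.
Qed.

Lemma imag_rootD a b : imag_root br (rho f) a -> imag_root br (rho f) b ->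
  root (a + b) -> imag_root br (rho f) (a + b).
Proof.
move=> /imag_rootP[ra ea] /imag_rootP[rb eb] rab; apply/imag_rootP; split=> // H.
by rewrite !add_lfunE ea eb opprD.
Qed.

Lemma imag_root_XcN a (e : R) : root a -> f (Xc a) = e *: Xc (- a) ->
  f (Xc (- a)) = e *: Xc a.
Proof.
move=> ra fa; rewrite -(tau_Xc chev ra) inv_tau fa linearZ /=.
by rewrite (tau_Xc chev (is_rootN chev ra)) opprK.
Qed.

Lemma imag_root_sign a : imag_root br (rho f) a ->
  exists2 e : R, e = 1 \/ e = -1 & f (Xc a) = e *: Xc (- a).
Proof.
move=> /imag_rootP[ra ea]; have rNa := is_rootN chev ra.
have [k fa] : exists k, f (Xc a) = k *: Xc (- a).
  apply: (rootspace_line chev rNa) => H.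
  rewrite -[vsval H]invK -inv_br -inv_cartanE (br_cartan_Xc chev) //.
  by rewrite linearZ /= ea opp_lfunE.
exists k => //; have := invK (Xc a); rewrite fa linearZ /= (imag_root_XcN ra fa).
rewrite scalerA -[RHS]scale1r => /eqP; rewrite -subr_eq0 -scalerBl scaler_eq0.
rewrite (negPf (Xc_neq0 chev ra)) orbF -expr2 subr_eq0 sqrf_eq1.
by move=> /orP[]/eqP; [left|right].
Qed.

(** Applying [tau] shows that the pairs (b, a) and (-b, -a) have the same structure constant, so
    signs multiply when the bracket is nonzero. *)
Lemma imag_root_sign_add a b (e1 e2 : R) : root a -> root b -> root (a + b) ->
    br (Xc b) (Xc a) != 0 ->
    f (Xc a) = e1 *: Xc (- a) -> f (Xc b) = e2 *: Xc (- b) ->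
  f (Xc (a + b)) = (e1 * e2) *: Xc (- (a + b)).
Proof.
move=> ra rb rab ba0 fa fb.
have [k kE] : exists k, br (Xc b) (Xc a) = k *: Xc (a + b).
  by apply: (br_Xc_root chev) => //; rewrite addrC.
have k0 : k != 0 by apply: contraNN ba0 => /eqP k0; rewrite kE k0 scale0r.
have kNE : br (Xc (- b)) (Xc (- a)) = k *: Xc (- (a + b)).
  by rewrite -!(tau_Xc chev) // -(tau_br chev) kE linearZ.
have := congr1 f kE; rewrite inv_br fa fb (brZl lieV) (brZr lieV) kNE.
rewrite [f (_ *: _)]linearZ /= => e; apply: (scalerI k0); rewrite -e !scalerA.
by congr (_ *: _); ring.
Qed.

End Involution.

Lemma involutive_limg (K : fieldType) (V : vectType K) (f : 'End(V)) :
  (forall X, f (f X) = X) -> limg f = fullv.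
Proof.
by move=> fK; apply/vspaceP => X; rewrite memvf -(fK X) memv_img ?memvf.
Qed.

Lemma in_Inv_tau_commute (R : realType) (V : vectType R) (br : V -> V -> V)
    (h : {vspace V}) (tau f : 'End(V)) :
    (forall X Y, f (br X Y) = br (f X) (f Y)) -> (forall X, f (f X) = X) ->
    (forall X, X \in h -> f X \in h) -> (forall X, f (tau X) = tau (f X)) ->
  in_Inv_tau br h tau f.
Proof.
move=> fbr fK fh ftau.
have gf z : gform tau z -> gform tau (antiext f z).
  case=> z1 z2; split; rewrite /antiext /=; first by rewrite -ftau z1.
  by rewrite (raddfN tau) /= -ftau z2 (raddfN f).
split=> //.
- by split=> //; split=> //; exact: involutive_limg.
- apply/eqP; rewrite eqEsubv; apply/andP; split; apply/subvP => X.
    by move=> /memv_imgP[Y Yh ->]; exact: fh.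
  by move=> Xh; rewrite -(fK X); apply: memv_img; exact: fh.
- move=> w gw; exists (antiext f w); split; first exact: gf.
  by case: w gw => w1 w2 _; rewrite /antiext /= (raddfN f) /= !fK opprK.
Qed.

(** * The Cayley transform along strongly orthogonal noncompact roots *)

Section CayleyTransform.
Variables (R : realType) (V : vectType R) (br : V -> V -> V) (h : {vspace V}).
Variables (Xc : dualh h -> V) (Hc : dualh h -> hR h) (tau : 'End(V)).
Hypothesis chev : chevalley_system br Xc Hc tau.
Variable sigma : 'End(V).
Hypothesis invs : in_Inv_tau br h tau sigma.
Variable M : seq (dualh h).
Hypothesis soM : so_noncompact br Xc sigma M.
Local Notation root := (@is_root R V br h).
Local Notation "<| a , b |>" := (@ip R V br h a b).
Implicit Types (a b g : dualh h) (H : hR h) (X Y : V).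
Let lieV := chev_lie chev.
Local Notation cay := (cayley_gen br Xc M).
Local Notation c := (expop cay (pi / 4)).
Local Notation c' := (expop cay (- (pi / 4))).
Local Notation imag := (imag_root br (rho sigma)).

Lemma noncompact_imag b : b \in M -> imag b.
Proof. by case: soM => _ nM _ /nM[]. Qed.

Lemma noncompact_root_in b : b \in M -> root b.
Proof. by move=> /noncompact_imag[]. Qed.

Lemma noncompact_sign b : b \in M -> sigma (Xc b) = -1 *: Xc (- b).
Proof. by case: soM => _ nM _ /nM[_ ->]; rewrite scaleN1r. Qed.

Lemma noncompact_so : so_roots br M.
Proof.
case: soM => uM nM so; split=> //; first exact: noncompact_root_in.
by move=> a b aM bM ab; case: (so _ _ aM bM ab).
Qed.

Lemma sigma_cayley_gen X : sigma (cay X) = - cay (sigma X).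
Proof.
rewrite !(adE lieV) (inv_br invs) -(brNl lieV); congr (br _ _).
rewrite linear_sum -sumrN; apply: eq_big_seq => b bM; rewrite linearD /=.
have rb := noncompact_root_in bM; have e := noncompact_sign bM.
by rewrite e (imag_root_XcN chev invs rb e) !scaleN1r opprD addrC.
Qed.

Lemma tau_cayley_gen X : tau (cay X) = cay (tau X).
Proof.
rewrite !(adE lieV) (tau_br chev); congr (br _ _).
rewrite linear_sum; apply: eq_big_seq => b bM; rewrite linearD /=.
have rb := noncompact_root_in bM; have rNb := is_rootN chev rb.
by rewrite !(tau_Xc chev) // opprK addrC.
Qed.

Lemma sigma_cayleyN X : sigma (c' X) = c (sigma X).
Proof.
rewrite -[in RHS](opprK (pi / 4)); apply: expop_anti => v.
exact: sigma_cayley_gen.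
Qed.

Lemma cayleyK X : c' (c X) = X. Proof. exact: expopNK. Qed.
Lemma cayleyNK X : c (c' X) = X.
Proof. by rewrite -{1}[pi / 4]opprK expopNK. Qed.

Definition cayley_inv : 'End(V) := (linfun c \o linfun c \o sigma)%VF.
Local Notation sigma' := cayley_inv.

Lemma cayley_invE X : sigma' X = c (c (sigma X)).
Proof. by rewrite !comp_lfunE !lfunE. Qed.

Lemma cayley_inv_conj X : sigma' X = c (sigma (c' X)).
Proof. by rewrite cayley_invE sigma_cayleyN. Qed.

Lemma cayley_inv_cartan H : sigma' (vsval H) =
  vsval (inv_cartan sigma H + \sum_(b <- M) (b H : R) *: Hc b).
Proof.
rewrite cayley_invE -(inv_cartanE invs) (quarter2_cartan chev _ noncompact_so).
congr (vsval (_ + _)); rewrite -sumrN; apply: eq_big_seq => b bM.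
have /(imag_rootP invs)[_ ->] := noncompact_imag bM.
by rewrite scaleNr opprK.
Qed.

Lemma cayley_inv_in_Inv_tau : in_Inv_tau br h tau sigma'.
Proof.
apply: in_Inv_tau_commute.
- by move=> X Y; rewrite !cayley_invE (inv_br invs) !(expop_cayley_gen_br chev).
- by move=> X; rewrite !cayley_inv_conj cayleyK (invK invs) cayleyNK.
- by move=> X Xh; rewrite -(vsprojK Xh) cayley_inv_cartan; exact: subvsP.
- move=> X; rewrite !cayley_invE (inv_tau chev invs).
  by rewrite !(expop_lfun tau_cayley_gen).
Qed.
Local Notation invs' := cayley_inv_in_Inv_tau.

(** The isomorphism is the complex-linear extension of c^-1, which intertwines the two
    involutions. *)
Lemma cayley_inv_iso : real_forms_iso br sigma' sigma.
Proof.
exists (fun z => (c' z.1, c' z.2)).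
have fixc' X : sigma' X = X -> sigma (c' X) = c' X.
  by rewrite cayley_inv_conj => /(congr1 c'); rewrite cayleyK.
have negc' X : sigma' X = - X -> sigma (c' X) = - c' X.
  by rewrite cayley_inv_conj => /(congr1 c'); rewrite cayleyK linearN.
split.
- by move=> z [z1 z2]; split; [exact: fixc'|exact: negc'].
- by move=> k z w _ _ /=; rewrite !(expop_is_linear cay (- (pi / 4)) k).
- move=> [z1 z2] [w1 w2] _ _ [e1 e2].
  by rewrite -(cayleyNK z1) -(cayleyNK z2) e1 e2 !cayleyNK.
- move=> [w1 w2] [/= e1 e2]; exists (c w1, c w2); split; last by rewrite /= !cayleyK.
  by split; rewrite /= cayley_inv_conj cayleyK ?e1 // e2 [LHS]linearN.
- move=> z w _ _; rewrite /cbr /=.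
  by rewrite (raddfB (expop cay (- (pi / 4)))) (raddfD (expop cay (- (pi / 4)))) /=
             !(expop_cayley_gen_br chev).
Qed.

Lemma cayley_imag_root a : imag_root br (rho sigma') a <->
  imag a /\ forall b, b \in M -> <| a, b |> = 0.
Proof.
have [uM rM so] := noncompact_so.
have invE H : inv_cartan sigma' H =
    inv_cartan sigma H + \sum_(b <- M) (b H : R) *: Hc b.
  apply: val_inj; transitivity (sigma' (vsval H)); first exact: (inv_cartanE invs').
  exact: cayley_inv_cartan.
(* The correction that the coroots of [M] add to a(sigma H). Since [sigma] negates the roots of [M],
   it is odd under [sigma]; comparing the imaginary condition at H and sigma H forces S = 0, and
   S(H_b) = 2 a(H_b) gives orthogonality to [b]. *)
pose S H : R := \sum_(b <- M) (b H : R) * (a (Hc b) : R).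
have aE H : (a (inv_cartan sigma' H) : R) = (a (inv_cartan sigma H) : R) + S H.
  rewrite invE [LHS]linearD; congr (_ + _); rewrite [LHS]dualh_sum.
  by apply: eq_bigr => b _; rewrite dualhZ.
split.
  move=> /(imag_rootP invs')[ra e].
  have e1 H : (a (inv_cartan sigma H) : R) + S H = - (a H : R) by rewrite -aE e.
  have SN H : S (inv_cartan sigma H) = - S H.
    rewrite /S -sumrN; apply: eq_big_seq => b bM.
    by have /(imag_rootP invs)[_ ->] := noncompact_imag bM; rewrite mulNr.
  have S0 H : S H = 0.
    have := e1 H; have := e1 (inv_cartan sigma H).
    by rewrite SN (inv_cartanK invs); lra.
  split.
    by apply/(imag_rootP invs); split=> // H; have := e1 H; rewrite S0 addr0.
  move=> b bM; have rb := rM _ bM; have := S0 (Hc b).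
  rewrite /S (bigD1_seq b) //= big1_seq ?addr0; last first.
    by move=> g /andP[gb gM]; rewrite (so_Hc chev noncompact_so) // mul0r.
  rewrite (root_Hc_self chev rb) (root_HcE chev a rb) (ipC chev b a) => /eqP.
  have b0 := ip_root_gt0 chev rb.
  by rewrite !mulf_eq0 invr_eq0 (gt_eqF b0) !pnatr_eq0 /= orbF => /eqP.
move=> [/(imag_rootP invs)[ra e] aM]; apply/(imag_rootP invs'); split=> // H.
rewrite [LHS]aE e /S big1_seq ?addr0 // => b /andP[_ bM].
by rewrite (root_HcE chev a (rM _ bM)) (ipC chev b a) aM // mulr0 mul0r mulr0.
Qed.

(* b is the only root of M that is not strongly orthogonal to a, and no other
   root of M interacts with a + b or a - b: this reduces the computation to
   the rank two system spanned by a and b. *)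
Lemma quarter2_orth_pair a b : root a -> (forall g, g \in M -> <| a, g |> = 0) ->
  b \in M -> root (a + b) -> c (c (Xc a)) = - Xc a.
Proof.
move=> ra aM bM rab; have [uM rM so] := noncompact_so.
have rb := rM _ bM; have rNb := is_rootN chev rb; have oab := aM _ bM.
have rmab := orth_pair_sub chev rb oab rab.
have oaNb : <| a, - b |> = 0 by rewrite ipNr oab oppr0.
apply: expop_quarter_turn.
have [e1 e2 e3 e4] := orth_pair_br chev ra rb oab rab.
set p := br (Xc b) (Xc a) in e1 e3; set q := br (Xc (- b)) (Xc a) in e2 e4.
have gsorth g : g \in M -> g != b ->
    [/\ sorth br g a, sorth br g (a + b) & sorth br g (a - b)].
  move=> gM gb; have rg := rM _ gM; have oag := aM _ gM.
  have rNg := is_rootN chev rg.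
  have [obg n1 n2] := so _ _ bM gM (contra_neq esym gb).
  have oaNg : <| a, - g |> = 0 by rewrite ipNr oag oppr0.
  have obNg : <| b, - g |> = 0 by rewrite ipNr obg oppr0.
  have [sD sB] := orth_pair_sorth chev ra rb rg oab oag obg rab.
  split; apply: (sorthC chev) => //; split=> //.
  - move=> rag; apply: n2.
    exact: (orth_triple chev ra rb rg oab oag obg rab rag).
  - move=> rag; apply: n1.
    have := orth_triple chev ra rb rNg oab oaNg obNg rab rag.
    by rewrite opprK.
have cayX X : (forall g, g \in M -> g != b ->
    br (Xc g) X = 0 /\ br (Xc (- g)) X = 0) ->
    cay X = br (Xc b) X + br (Xc (- b)) X.
  move=> X0; rewrite (cayley_genE chev) (bigD1_seq b) //= big1_seq ?addr0 //.
  by move=> g /andP[gb gM]; have [-> ->] := X0 g gM gb; rewrite addr0.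
have br0 g x : g \in M -> root x -> sorth br g x ->
    br (Xc g) (Xc x) = 0 /\ br (Xc (- g)) (Xc x) = 0.
  move=> gM rx sgx; have rg := rM _ gM; have rNg := is_rootN chev rg.
  by split; apply: (sorth_br chev) => //; exact: (sorthNl chev).
rewrite [cay (Xc a)]cayX -/p -/q; last first.
  by move=> g gM gb; have [s1 _ _] := gsorth g gM gb; exact: br0.
have [k1 pE] : exists k, p = k *: Xc (a + b).
  by apply: (br_Xc_root chev) => //; rewrite addrC.
have [k2 qE] : exists k, q = k *: Xc (a - b).
  by apply: (br_Xc_root chev) => //; rewrite addrC.
rewrite cayX; last first.
  move=> g gM gb; have [_ s2 s3] := gsorth g gM gb.
  have [h1 h2] := br0 g _ gM rab s2; have [h3 h4] := br0 g _ gM rmab s3.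
  by rewrite pE qE !(brDr lieV) !(brZr lieV) h1 h2 h3 h4 !scaler0 addr0.
rewrite !(brDr lieV) e1 e2 e3 e4 add0r addr0 -opprD -scalerDl.
by congr (- (_ *: _)); ring.
Qed.

Lemma quarter2_sorth a : root a -> (forall g, g \in M -> sorth br a g) ->
  c (c (Xc a)) = Xc a.
Proof.
move=> ra aM; have [uM rM so] := noncompact_so.
suff k0 : cay (Xc a) = 0 by rewrite !expop_ker.
rewrite (cayley_genE chev) big1_seq // => g /andP[_ gM].
have rg := rM _ gM; have rNg := is_rootN chev rg; have sga := sorthC chev (aM _ gM).
by rewrite !(sorth_br chev) ?addr0 //; exact: (sorthNl chev).
Qed.

End CayleyTransform.

(** * Consequences of the maximal choice of M *)

Section Maximality.
Variables (R : realType) (V : vectType R) (br : V -> V -> V) (h : {vspace V}).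
Variables (Xc : dualh h -> V) (Hc : dualh h -> hR h) (tau : 'End(V)).
Hypothesis chev : chevalley_system br Xc Hc tau.
Variable sigma : 'End(V).
Hypothesis invs : in_Inv_tau br h tau sigma.
Local Notation root := (@is_root R V br h).
Local Notation "<| a , b |>" := (@ip R V br h a b).
Local Notation imag := (imag_root br (rho sigma)).
Implicit Types (a b g : dualh h) (M : seq (dualh h)).

(** Induction on the room left: the size of such a set is at most the number of roots. *)
Lemma so_noncompact_extend M : so_noncompact br Xc sigma M ->
  exists M', maximal_so br Xc sigma M' /\ {subset M <= M'}.
Proof.
have szle N : so_noncompact br Xc sigma N -> (size N <= size (root_seq chev))%N.
  case=> uN nN _; apply: uniq_leq_size => // a /nN[[ra _] _]; exact/root_seqP.
have grow N : so_noncompact br Xc sigma N -> ~ maximal_so br Xc sigma N ->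
    exists N', [/\ so_noncompact br Xc sigma N', {subset N <= N'}
      & (size N < size N')%N].
  move=> soN /not_andP[//|/existsNP[N' /not_implyP[soN' /not_implyP[NN' N'N]]]].
  exists N'; split=> //; rewrite ltnNge; apply/negP => leN'N; apply: N'N => a.
  have [uN _ _] := soN.
  by have [_ ->] := uniq_min_size uN NN' leN'N.
have [n] := ubnP (size (root_seq chev) - size M).
elim: n M => // n ih M ltn soM.
have [mM|/(grow _ soM)[N [soN MN ltMN]]] := pselect (maximal_so br Xc sigma M).
  by exists M; split.
have [|M' [mM' NM']] := ih N _ soN; first by have := szle _ soN; lia.
by exists M'; split=> // a /MN /NM'.
Qed.

Lemma nlong_subset M M' : uniq M -> {subset M <= M'} ->
  (nlong br M <= nlong br M')%N.
Proof.
move=> uM MM'; rewrite /nlong -!size_filter uniq_leq_size ?filter_uniq // => a.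
by rewrite !mem_filter => /andP[-> /MM' ->].
Qed.

Lemma sorth_strongly a b : root a -> sorth br a b -> strongly_orth br a b.
Proof.
move=> ra [ab nD nB]; split=> //; apply/negP => /eqP e.
by have := ip_root_gt0 chev ra; rewrite {2}e ab ltxx.
Qed.

Variable M : seq (dualh h).
Hypothesis maxM : maximal_so br Xc sigma M.
Hypothesis longM : forall M', maximal_so br Xc sigma M' ->
  (nlong br M' <= nlong br M)%N.

Let soM : so_noncompact br Xc sigma M. Proof. by case: maxM. Qed.

(* Otherwise b could be traded for the two long roots a + b and a - b. *)
Lemma orth_pair_not_compact a b : imag a ->
    (forall g, g \in M -> <| a, g |> = 0) -> b \in M -> root (a + b) ->
  sigma (Xc a) <> Xc (- a).
Proof.
move=> ia aM bM rab fa; have [uM rM so] := noncompact_so soM.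
have [_ nM _] := soM; have ra : root a by case: ia.
have rb := rM _ bM; have rNb := is_rootN chev rb; have oab := aM _ bM.
have b0 := ip_root_gt0 chev rb.
have ib := noncompact_imag soM bM.
have rmab := orth_pair_sub chev rb oab rab.
have nab := orth_pair_norm chev ra rb oab rab.
have oba : <| b, a |> = 0 by rewrite (ipC chev).
have oaNb : <| a, - b |> = 0 by rewrite ipNr oab oppr0.
have fb := noncompact_sign soM bM.
have fNb := imag_root_XcN chev invs rb fb.
have fa1 : sigma (Xc a) = 1 *: Xc (- a) by rewrite scale1r.
have ncD : noncompact_root br Xc sigma (a + b).
  split; first exact: (imag_rootD invs).
  rewrite (imag_root_sign_add chev invs ra rb rab _ fa1 fb) ?mul1r ?scaleN1r //.
  exact: (orth_pair_br_neq0 chev).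
have ncB : noncompact_root br Xc sigma (a - b).
  split; first exact: (imag_rootD invs ia (imag_rootN chev invs ib)).
  rewrite (@imag_root_sign_add _ _ _ _ _ _ _ chev _ invs _ _ 1 (-1) ra rNb rmab) //.
  - by rewrite mul1r scaleN1r.
  - exact: (orth_pair_br_neq0 chev).
  - by rewrite opprK.
have ipbD : <| b, a + b |> = <| b, b |> by rewrite ipDr oba add0r.
have ipbB : <| b, a - b |> = - <| b, b |> by rewrite ipDr ipNr oba add0r.
pose N := rem b M.
have memN g : g \in N -> [/\ g \in M, g != b & <| b, g |> = 0].
  rewrite mem_rem_uniq // inE => /andP[gb gM]; split=> //.
  by have [] := so _ _ bM gM (contra_neq esym gb).
have sDB : sorth br (a + b) (a - b).
  split.
  - by rewrite (ipDl chev) !ipDr !ipNr oab oba nab; ring.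
  - by rewrite addrACA subrr addr0; exact: (root_double chev).
  - by rewrite opprB [a + b]addrC addrACA subrr addr0; exact: (root_double chev).
have sN g : g \in N -> sorth br (a + b) g /\ sorth br (a - b) g.
  move=> /memN[gM _ obg].
  exact: (orth_pair_sorth chev ra rb (rM _ gM) oab (aM _ gM) obg rab).
have soM' : so_noncompact br Xc sigma [:: a + b, a - b & N].
  split.
  - rewrite /= !inE negb_or rem_uniq // andbT.
    apply/andP; split; first (apply/andP; split).
    + by apply/negP => /eqP e; have := ipbD; rewrite e ipbB; lra.
    + by apply/negP => /memN[_ _]; rewrite ipbD; lra.
    + by apply/negP => /memN[_ _]; rewrite ipbB; lra.
  - by move=> g; rewrite !inE => /or3P[/eqP ->|/eqP ->|/memN[/nM]].
  - move=> x y xM yM xy; apply: sorth_strongly.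
      move: xM; rewrite !inE => /or3P[/eqP ->|/eqP ->|/memN[/rM]] //.
    move: xM yM xy; rewrite !inE.
    move=> /or3P[/eqP ->|/eqP ->|xN] /or3P[/eqP ->|/eqP ->|yN] xy;
      rewrite ?eqxx // in xy *.
    + by case: (sN _ yN).
    + exact: (sorthC chev).
    + by case: (sN _ yN).
    + by apply: (sorthC chev); case: (sN _ xN).
    + by apply: (sorthC chev); case: (sN _ xN).
    + by have [xM _ _] := memN _ xN; have [yM _ _] := memN _ yN; exact: so.
(* The traded set need not be maximal, but an extension of it is, and extending cannot lower the
   number of long roots. *)
have [M1 [maxM1 sub]] := so_noncompact_extend soM'.
have uM' : uniq [:: a + b, a - b & N] by case: soM'.
have := leq_trans (nlong_subset uM' sub) (longM maxM1).
have lD : long_root br (a + b) := long_orth_sum chev ra rb oab rab.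
have lB : long_root br (a - b) := long_orth_sum chev ra rNb oaNb rmab.
(* The root a + b lies in the component of [b] and has twice its squared length. The trade thus
   loses no long root and gains two. *)
have nlb : ~ long_root br b.
  move=> [_ /(_ _ rab)]; rewrite (ipDl chev) !ipDr oab oba nab add0r addr0.
  move=> le; have : same_component br b (a + b).
    by apply: rt_step; do 2!split=> //; rewrite ipbD; lra.
  by move=> /le; lra.
have -> : nlong br M = nlong br (b :: N) by apply/permP; exact: perm_to_rem.
rewrite /nlong /= (asboolT lD) (asboolT lB) (asboolF nlb) /=; lia.
Qed.

Lemma cayley_inv_compact a : imag a -> (forall b, b \in M -> <| a, b |> = 0) ->
  cayley_inv br Xc sigma M (Xc a) = Xc (- a).
Proof.
move=> ia aM; have ra : root a by case: ia.
have rNa := is_rootN chev ra; have [uM rM so] := noncompact_so soM.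
have [e es fa] := imag_root_sign chev invs ia.
rewrite cayley_invE fa !linearZ /=.
(* It suffices to ask about a + b: by reflection, a - b is a root exactly when a + b is. Since sigma
   X_a is a multiple of X_(-a), the square of c is then evaluated at the root [- a]. *)
have [[b bM rab]|noP] := pselect (exists2 b, b \in M & root (a + b)).
  rewrite (quarter2_orth_pair chev soM rNa _ bM).
  - case: es fa => -> fa; last by rewrite scaleN1r opprK.
    by case: (orth_pair_not_compact ia aM bM rab); rewrite fa scale1r.
  - by move=> g gM; rewrite (ipNl chev) aM ?oppr0.
  - have := is_rootN chev (orth_pair_sub chev (rM _ bM) (aM _ bM) rab).
    by rewrite opprB addrC.
have sa g : g \in M -> sorth br a g.
  move=> gM; split; [exact: aM| |].
    by move=> rag; apply: noP; exists g.
  move=> rag; apply: noP; exists g => //.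
  have := orth_pair_sub chev (is_rootN chev (rM _ gM)) _ rag.
  by rewrite opprK; apply; rewrite ipNr aM ?oppr0.
rewrite (quarter2_sorth chev soM rNa); last by move=> g gM; exact/(sorthNl chev)/sa.
case: es fa => -> fa; first by rewrite scale1r.
(* The remaining case: [a] is noncompact and strongly orthogonal to [M], so adjoining it contradicts
   maximality. *)
case: maxM => _ max.
have aNM : a \notin M.
  by apply/negP => /aM aa; have := ip_root_gt0 chev ra; rewrite aa ltxx.
have soaM : so_noncompact br Xc sigma (a :: M).
  have [_ nM soM'] := soM; split.
  - by rewrite /= aNM.
  - move=> g; rewrite inE => /predU1P[->|/nM //].
    by split; rewrite // fa scaleN1r.
  - move=> x y; rewrite !inE => /predU1P[->|xM] /predU1P[->|yM] xy.
    + by rewrite eqxx in xy.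
    + exact/sorth_strongly/sa.
    + by apply: sorth_strongly; [exact: rM|exact/(sorthC chev)/sa].
    + exact: soM'.
have sub : {subset M <= a :: M} by move=> g gM; rewrite inE gM orbT.
by move: aNM; rewrite (max _ soaM sub a) // inE eqxx.
Qed.

End Maximality.

Theorem theorem4p12 (R : realType) (V : vectType R) (br : V -> V -> V)
  (h : {vspace V}) (Xc : dualh h -> V) (Hc : dualh h -> hR h) (tau : 'End(V))
  (s : 'End(dualh h)) (sigma : 'End(V)) (M : seq (dualh h)) :
  @chevalley_system R V br h Xc Hc tau ->
  @in_IPhi R V br h s ->
  @in_Inv_tau R V br h tau sigma ->
  (forall alpha, s alpha = @rho R V h sigma alpha) ->
  @maximal_so R V br h Xc sigma M ->
  (forall M', @maximal_so R V br h Xc sigma M' ->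
     (@nlong R V br h M' <= @nlong R V br h M)%N) ->
  exists sigma' : 'End(V),
    [/\ @in_Inv_tau R V br h tau sigma',
        @real_forms_iso R V br sigma' sigma,
        (forall alpha, @compact_root R V br h Xc sigma' alpha <->
           (@imag_root R V br h s alpha /\
            forall beta, beta \in M -> @ip R V br h alpha beta = 0))
      & forall alpha, ~ @noncompact_root R V br h Xc sigma' alpha].
Proof.
move=> chev _ invs sE maxM longM; have soM : so_noncompact br Xc sigma M by case: maxM.
have imagE a : imag_root br s a <-> imag_root br (rho sigma) a.
  by rewrite /imag_root sE.
have compact a : imag_root br (rho (cayley_inv br Xc sigma M)) a ->
    cayley_inv br Xc sigma M (Xc a) = Xc (- a).
  by move=> /(cayley_imag_root chev invs soM)[]; exact: (cayley_inv_compact chev).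
exists (cayley_inv br Xc sigma M); split.
- exact: (cayley_inv_in_Inv_tau chev).
- exact: (cayley_inv_iso chev).
- move=> a; split.
    by move=> [/(cayley_imag_root chev invs soM)[/imagE]].
  move=> [/imagE ia aM].
  have ia' : imag_root br (rho (cayley_inv br Xc sigma M)) a.
    exact/(cayley_imag_root chev invs soM).
  by split=> //; exact: compact.
(* An imaginary root of both types would give 2 X_(-a) = 0. *)
- move=> a [ia]; rewrite compact // => /eqP.
  rewrite -subr_eq0 opprK -mulr2n -scaler_nat scaler_eq0 pnatr_eq0 /=.
  have ra : is_root br a by case: ia.
  by rewrite (negPf (Xc_neq0 chev (is_rootN chev ra))).
Qed.
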